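(* Let $\mathbf d=(d_1,\dots,d_k)$ with $1\le d_1<\dots<d_k\le n$. The map $$(V_{i,j})_{(i,j)\in P_{\mathbf d}}\mapsto(V_{d_i,d_i})_{i=1}^k$$ is a birational surjective map from $SpR_{\mathbf d}$ to $Sp\mathcal F^a_{\mathbf d}$.
   Context: The base field is $\mathbb C$. $W$ is a $2n$-dimensional vector space with basis $w_1,\dots,w_{2n}$ and symplectic form with $\langle w_i,w_{2n+1-i}\rangle=1$ for $1\le i\le n$, $\langle w_i,w_j\rangle=0$ for $j\ne2n+1-i$. $pr_k(\sum_ic_iw_i)=\sum_{i\ne k}c_iw_i$, and $W_{i,j}=\mathrm{span}(w_1,\dots,w_i,w_{j+1},\dots,w_{2n})$. $Sp\mathcal F^a_{\mathbf d}$ is the symplectic degenerate flag variety, realized as the variety of collections $(V_i)_{i=1}^k$ of subspaces of $W$ with $\dim V_i=d_i$, $pr_{d_i+1}\cdots pr_{2n-d_i}(V_i)$ isotropic for all $i$, and $pr_{d_i+1}\cdots pr_{d_{i+1}}V_i\subset V_{i+1}$ for $1\le i\le k-1$. $P_{\mathbf d}$ is the set of pairs $(i,j)$ with $1\le i\le j$, $i+j\le2n$ and $i\le d_l\le j$ for some $l$. The variety $SpR_{\mathbf d}\subset\prod_{(i,j)\in P_{\mathbf d}}Gr_i(W_{i,j})$ consists of collections of subspaces $V_{i,j}\subset W$, $(i,j)\in P_{\mathbf d}$, such that $\dim V_{i,j}=i$, $V_{i,j}\subset W_{i,j}$; $V_{i,j}\subset V_{i+1,j}$ and $pr_{j+1}V_{i,j}\subset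 V_{i,j+1}$ (whenever both indices are in $P_{\mathbf d}$); and the spaces $V_{i,2n-i}$ with $(i,2n-i)\in P_{\mathbf d}$ are isotropic. *)

(* Defs.v *)
From HB Require Import structures.
From mathcomp Require Import all_boot all_order all_algebra.
From mathcomp Require Import complex zify.
From mathcomp Require Import all_classical reals topology.
From mathcomp Require Import -(notations) mpoly.

Set Implicit Arguments.
Unset Strict Implicit.
Unset Printing Implicit Defensive.

Import GRing.Theory.

Local Open Scope classical_set_scope.
Local Open Scope ring_scope.

(* Products of Grassmannians \prod_s Gr_(r s)(F^N). *)

Record grprod (F : fieldType) (I : finType) (r : I -> nat) (N : nat) := GrProd {
  gr_fun :> {ffun I -> {vspace 'rV[F]_N}};
  _ : [forall s, \dim (gr_fun s) == r s] }.

HB.instance Definition _ (F : fieldType) (I : finType) (r : I -> nat) (N : nat) :=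
  [isSub for @gr_fun F I r N].
HB.instance Definition _ (F : fieldType) (I : finType) (r : I -> nat) (N : nat) :=
  [Choice of grprod F r N by <:].

(* The variety structure is that of the geometric quotient of the space of
   families of bases ("frames") by \prod_s GL_(r s): a set is Zariski open, and a
   function is regular, iff it becomes so after pulling back to the frames, which
   form an open subset of the affine space \prod_s 'M_(r s, N).  Since the
   quotient map has sections locally, this is the usual structure, on the product
   and on each of its locally closed subsets. *)
Section ZariskiGrassmannian.
Variables (F : fieldType) (I : finType) (r : I -> nat) (N : nat).

Definition frame := forall s : I, 'M[F]_(r s, N).

Definition is_frame (A : frame) (V : grprod F r N) : Prop :=
  forall s, basis_of (V s) [seq row a (A s) | a <- enum 'I_(r s)].

Definition frame_var : finType := {s : I & ('I_(r s) * 'I_N)%type}.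

Definition frame_poly := mpoly #|{: frame_var}| F.

Definition frame_eval (p : frame_poly) (A : frame) : F :=
  meval (fun t => let x := enum_val t in
                        A (tag x) (tagged x).1 (tagged x).2) p.

Definition zariski_open (U : set (grprod F r N)) : Prop :=
  exists S : set frame_poly, forall A V, is_frame A V ->
    (U V <-> exists2 p, S p & frame_eval p A != 0).

Lemma zariski_openT : zariski_open setT.
Proof.
exists [set 1] => A V _; split=> // _; exists 1 => //.
by rewrite /frame_eval meval1 oner_neq0.
Qed.

Lemma zariski_openI : setI_closed zariski_open.
Proof.
move=> U1 U2 [S1 H1] [S2 H2].
exists [set p | exists p1 p2, [/\ S1 p1, S2 p2 & p = p1 * p2]] => A V AV.
split.
  move=> [/(H1 _ _ AV)[p1 S1p1 p1A] /(H2 _ _ AV)[p2 S2p2 p2A]].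
  exists (p1 * p2); first by exists p1, p2.
  by rewrite /frame_eval mevalM mulf_neq0.
move=> [_ [p1 [p2 [S1p1 S2p2 ->]]]].
rewrite /frame_eval mevalM mulf_eq0 negb_or => /andP[p1A p2A].
by split; [apply/(H1 _ _ AV); exists p1 | apply/(H2 _ _ AV); exists p2].
Qed.

Lemma zariski_open_bigU (J : Type) (f : J -> set (grprod F r N)) :
  (forall i, zariski_open (f i)) -> zariski_open (\bigcup_i f i).
Proof.
move=> fo.
exists [set p | forall A V, is_frame A V -> frame_eval p A != 0 ->
                (\bigcup_i f i) V] => A V AV.
split; last by move=> [p /(_ _ _ AV)].
move=> [i _ fiV]; have [S HS] := fo i.
have [p Sp pA] := (HS _ _ AV).1 fiV; exists p => // A' V' AV' pA'.
by exists i => //; apply/(HS _ _ AV'); exists p.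
Qed.

HB.instance Definition _ := isOpenTopological.Build (grprod F r N)
  zariski_openT zariski_openI zariski_open_bigU.

Lemma open_zariski (U : set (grprod F r N)) : open U <-> zariski_open U.
Proof.
rewrite openE; split=> /=; last first.
  by move=> Uo V UV; exists U; split.
move=> UU; have -> : U = \bigcup_(B : {B | zariski_open B /\ B `<=` U}) sval B.
  apply/seteqP; split=> [V /UU [B [Bo BV BU]]|V [[B [Bo BU]] _ /= BV]].
    by exists (exist _ B (conj Bo BU)).
  exact: BU.
by apply: zariski_open_bigU => -[B []].
Qed.

(* [f] is a regular function on [X]; its values outside [X] are irrelevant. *)
Definition regular_on (X : set (grprod F r N)) (f : grprod F r N -> F) : Prop :=
  forall A0 V0, X V0 -> is_frame A0 V0 ->
  exists p q : frame_poly, frame_eval q A0 != 0 /\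
    forall A V, X V -> is_frame A V -> frame_eval q A != 0 ->
      f V = frame_eval p A / frame_eval q A.

Definition open_in (X U : set (grprod F r N)) : Prop :=
  exists O, open O /\ U = X `&` O.

Definition dense_in (X U : set (grprod F r N)) : Prop :=
  U `<=` X /\ X `<=` closure U.

End ZariskiGrassmannian.

Section Morphisms.
Variables (F : fieldType) (I J : finType) (r : I -> nat) (s : J -> nat).
Variables (M N : nat).
Implicit Types (X : set (grprod F r M)) (Y : set (grprod F s N)).

Definition morphism X Y (phi : grprod F r M -> grprod F s N) : Prop :=
  [/\ set_fun X Y phi,
      {within X, continuous phi} &
      forall (O : set (grprod F s N)) (f : grprod F s N -> F),
        open O -> regular_on (Y `&` O) f ->
        regular_on (X `&` phi @^-1` O) (f \o phi)].

End Morphisms.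

Section Birational.
Variables (F : fieldType) (I J : finType) (r : I -> nat) (s : J -> nat).
Variables (M N : nat).
Implicit Types (X : set (grprod F r M)) (Y : set (grprod F s N)).

Definition isomorphism X Y (phi : grprod F r M -> grprod F s N) : Prop :=
  morphism X Y phi /\
  exists psi : grprod F s N -> grprod F r M,
    [/\ morphism Y X psi,
        forall x, X x -> psi (phi x) = x &
        forall y, Y y -> phi (psi y) = y].

Definition birational_morphism X Y (phi : grprod F r M -> grprod F s N) : Prop :=
  morphism X Y phi /\
  exists U V, [/\ open_in X U, dense_in X U, open_in Y V, dense_in Y V &
                  isomorphism U V phi].

End Birational.

(* Indices of basis vectors, projections and subspaces W_{i,j} are 1-based natural
   numbers; the coordinate of w_k is the ordinal of value k - 1. *)
Section SymplecticSpace.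
Variables (F : fieldType) (n : nat).
Local Notation W := 'rV[F]_(2 * n).

Definition w (k : nat) : W := \row_(j < 2 * n) (j.+1 == k)%:R.

(* [rev_ord] exchanges the coordinates of w_i and w_{2n+1-i}. *)
Definition omega (u v : W) : F :=
  \sum_(i < 2 * n) (-1) ^+ (n <= i)%N * u 0 i * v 0 (rev_ord i).

Lemma omega_w (i j : nat) : (1 <= i <= n)%N -> (1 <= j <= 2 * n)%N ->
  omega (w i) (w j) = (j == 2 * n + 1 - i)%N%:R.
Proof.
move=> /andP[i1 ni] /andP[j1 nj]; have i2n : (i.-1 < 2 * n)%N by lia.
rewrite /omega (bigD1 (Ordinal i2n)) //= big1 ?addr0 => [|l li]; last first.
  rewrite !mxE; have /negbTE-> : l.+1 != i; last by rewrite mulr0 mul0r.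
  by apply: contraNneq li => li; apply/eqP/val_inj; rewrite /= -li.
rewrite !mxE /= (_ : (n <= i.-1)%N = false) ?expr0 ?mul1r; last by lia.
by rewrite prednK // eqxx mul1r; congr (nat_of_bool _)%:R; lia.
Qed.

Lemma omegaC (u v : W) : omega u v = - omega v u.
Proof.
rewrite /omega (reindex_inj rev_ord_inj) -sumrN; apply: eq_bigr => i _.
rewrite rev_ordK /= (_ : (n <= 2 * n - i.+1)%N = ~~ (n <= i)%N); last first.
  by have := ltn_ord i; lia.
by rewrite signrN !mulNr -!mulrA (mulrC (u _ _)).
Qed.

Definition isotropic (U : {vspace W}) : Prop :=
  forall u v, u \in U -> v \in U -> omega u v = 0.

Definition pr_fun (k : nat) (v : W) : W :=
  \row_(j < 2 * n) if j.+1 == k then 0 else v 0 j.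

Lemma pr_fun_is_linear k : linear (pr_fun k).
Proof.
move=> a u v; apply/rowP=> j; rewrite !mxE.
by case: ifP; rewrite ?mulr0 ?addr0.
Qed.

HB.instance Definition _ k :=
  GRing.isLinear.Build F W W _ (pr_fun k) (pr_fun_is_linear k).

Definition pr (k : nat) : 'End(W) := linfun (pr_fun k).

(* pr_a pr_{a+1} ... pr_b, the identity if b < a. *)
Definition prs (a b : nat) : 'End(W) :=
  \big[@comp_lfun F W W W/@id_lfun F W]_(a <= k < b.+1) pr k.

Definition Wsub (i j : nat) : {vspace W} :=
  <<[seq w a | a <- index_iota 1 i.+1 ++ index_iota j.+1 (2 * n).+1]>>%VS.

End SymplecticSpace.

Section Varieties.
Variables (F : fieldType) (n k : nat) (d : 'I_k -> nat).

Definition in_P (i j : nat) : bool :=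
  [&& (1 <= i)%N, (i <= j)%N, (i + j <= 2 * n)%N & [exists l, (i <= d l <= j)%N]].

(* The bounds i, j < 2 * n follow from [in_P]. *)
Definition P_d : finType :=
  {p : 'I_(2 * n) * 'I_(2 * n) | in_P p.1 p.2}.

Definition fst_P (p : P_d) : nat := (val p).1.
Definition snd_P (p : P_d) : nat := (val p).2.

Definition SpF : set (grprod F d (2 * n)) :=
  [set V | (forall l, isotropic (prs F n (d l).+1 (2 * n - d l) @: V l)%VS) /\
           (forall l m : 'I_k, m = l.+1 :> nat ->
              (prs F n (d l).+1 (d m) @: V l <= V m)%VS)].

Definition SpR : set (grprod F fst_P (2 * n)) :=
  [set V | [/\ forall p, (V p <= Wsub F n (fst_P p) (snd_P p))%VS,
               forall p q, fst_P q = (fst_P p).+1 -> snd_P q = snd_P p ->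
                 (V p <= V q)%VS,
               forall p q, fst_P q = fst_P p -> snd_P q = (snd_P p).+1 ->
                 (pr F n (snd_P p).+1 @: V p <= V q)%VS &
               forall p, (fst_P p + snd_P p = 2 * n)%N -> isotropic (V p)]].

End Varieties.

Arguments SpF F n {k} d.
Arguments SpR F n {k} d.

Section DiagonalMap.
Variables (F : fieldType) (n k : nat) (d : 'I_k -> nat).
Hypothesis d_range : forall l, (1 <= d l <= n)%N.

Lemma d_lt (l : 'I_k) : (d l < 2 * n)%N.
Proof.
have /andP[d1 dn] := d_range l.
by rewrite mul2n -addnn -addn1 leq_add // (leq_trans d1).
Qed.

Lemma diag_in_P (l : 'I_k) :
  in_P n d (Ordinal (d_lt l)) (Ordinal (d_lt l)).
Proof.
have /andP[d1 dn] := d_range l; rewrite /in_P /= d1 leqnn mul2n -addnn leq_add //=.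
by apply/existsP; exists l; rewrite leqnn.
Qed.

Definition diag (l : 'I_k) : P_d n d :=
  exist _ (Ordinal (d_lt l), Ordinal (d_lt l)) (diag_in_P l).

Lemma diag_dim (V : grprod F (@fst_P n k d) (2 * n)) :
  [forall l, \dim ([ffun l => V (diag l)] l) == d l].
Proof.
by apply/forallP=> l; rewrite ffunE; case: V => V /= /forallP/(_ (diag l)).
Qed.

Definition diag_map (V : grprod F (@fst_P n k d) (2 * n)) : grprod F d (2 * n) :=
  GrProd (diag_dim V).

End DiagonalMap.

(* Main.v *)
Require Import Defs.
From mathcomp Require Import all_boot all_order all_algebra.
From mathcomp Require Import complex zify.
From mathcomp Require Import all_classical reals topology.
From mathcomp Require Import -(notations) mpoly.

(** Write V_{i,j} for the spaces of a point of SpR and V_l for those of a point of SpF. A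
    point of a product of Grassmannians is handled through its frames, that is families of
    bases, written as matrices; a map which lifts to a polynomial map of frames is a morphism
    (frame_map_morphism). The map to the diagonal is such a map, as it forgets matrices.

    Surjectivity (diag_map_surj). A degenerate flag (V_l) is completed to a full one,
    C_1, ..., C_n with C_n Lagrangian (full_flag), and the other positions (i, j) are then
    filled by increasing j - i (fill_triangle): what is already there gives a lower bound of
    dimension at most i and an upper bound of dimension at least i, and on the antidiagonal
    an isotropic space to be extended to a Lagrangian one.

    Birationality. The open cell consists of the (V_l) with nonzero leftmost maximal minors.
    Over it, V_{i,j} must be spanned by the projections of the first i rows of the reduced
    echelon form of V_l, for any l with i <= d_l <= j (chart_frame). Hence a point of SpR over
    the cell is determined by its diagonal, and up to the factor \det (corner A), which does
    not change spans, the inverse map is polynomial in frames (chart_inverse).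

    Density of the preimage of the cell (chart_dense). SpR is a tower of projective lines: in
    the order of decreasing j and increasing i, V_{i,j} is a choice of a line in a
    two-dimensional quotient determined by the previous spaces. So a point can be moved
    generically one position after the other; this is done by polynomial curves
    of frames in a parameter t, starting at the given point for t = 0. Inside the triangle the
    new basis vector is a combination of vectors of the next column, whose last coefficient is
    made a nonconstant function of t (interior_vectors); on the antidiagonal it is a solution
    of the orthogonality equations, deformed by Cramer's rule (edge_vector). All the minors are
    nonzero polynomials in t, so the curve meets the preimage of the cell in every
    neighbourhood of the point. Density in SpF follows by surjectivity and continuity. *)

Set Implicit Arguments.
Unset Strict Implicit.
Unset Printing Implicit Defensive.

Import GRing.Theory.

Local Open Scope classical_set_scope.
Local Open Scope ring_scope.

(** * Frames of a point in a product of Grassmannians *)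

Section RowSpans.
Variable F : fieldType.

Lemma span_rowsP m N (M : 'M[F]_(m, N)) (v : 'rV_N) :
  reflect (exists c, v = c *m M) (v \in <<[seq row a M | a <- enum 'I_m]>>%VS).
Proof.
apply: (iffP idP) => [|[c ->]]; last first.
  rewrite mulmx_sum_row; apply: memv_suml => a _.
  by apply/memvZ/memv_span/map_f; rewrite mem_enum.
rewrite span_def big_map big_enum /= => /memv_sumP [u uM ->].
have /choice[c cP] : forall a, exists k, u a = k *: row a M.
  by move=> a; have /vlineP := uM a isT.
exists (\row_a c a); rewrite mulmx_sum_row; apply: eq_bigr => a _.
by rewrite mxE.
Qed.

(** Reduces the statement that the rows of a matrix form a basis, which is how frames are
    defined, to a dimension count and a description of the members of the subspace. *)
Lemma basis_rowsP m N (M : 'M[F]_(m, N)) (U : {vspace 'rV[F]_N}) :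
  basis_of U [seq row a M | a <- enum 'I_m] <->
  \dim U = m /\ forall v, v \in U <-> exists c, v = c *m M.
Proof.
split=> [bU|[dU UM]].
  split; first by rewrite -(@vector.size_basis _ _ _ _ [tuple row a M | a < m] bU).
  by move=> v; rewrite -(span_basis bU); split=> /span_rowsP.
rewrite basisEdim dU size_map size_enum_ord leqnn andbT.
by apply/subvP=> v /UM/span_rowsP.
Qed.

Lemma basis_rows_free m N (M : 'M[F]_(m, N)) (U : {vspace 'rV[F]_N}) :
  basis_of U [seq row a M | a <- enum 'I_m] -> row_free M.
Proof.
move=> /basis_free /(@freeP _ _ _ [tuple row a M | a < m]) fM.
rewrite -kermx_eq0; apply/eqP/row_matrixP=> i; rewrite row0.
have : row i (kermx M) *m M = 0 by rewrite -row_mul mulmx_ker row0.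
rewrite mulmx_sum_row => cM; apply/rowP=> a; rewrite [RHS]mxE.
apply: (fM (fun a => row i (kermx M) 0 a)); rewrite -[RHS]cM.
by apply: eq_bigr => b _; rewrite -tnth_nth tnth_mktuple.
Qed.

Lemma free_rows_basis m N (M : 'M[F]_(m, N)) :
  row_free M ->
  basis_of <<[seq row a M | a <- enum 'I_m]>>%VS [seq row a M | a <- enum 'I_m].
Proof.
move=> fM; rewrite /basis_of eqxx /=; apply/(freeP (X := [tuple row a M | a < m])).
move=> k k0 a; have /row_freeP[B MB] := fM.
have : (\row_b k b) *m M = 0.
  rewrite mulmx_sum_row -[RHS]k0; apply: eq_bigr => b _.
  by rewrite mxE -tnth_nth tnth_mktuple.
move=> /(congr1 (mulmx^~ B)); rewrite -mulmxA MB mulmx1 mul0mx => /rowP/(_ a).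
by rewrite !mxE.
Qed.

End RowSpans.

Section Frames.
Variables (F : fieldType) (I : finType) (r : I -> nat) (N : nat).
Implicit Types (A B : frame F r N) (V : grprod F r N).

Lemma grprod_dim V s : \dim (V s) = r s.
Proof. by case: V => V /= /forallP/(_ s)/eqP. Qed.

Lemma frameP A V : is_frame A V <-> forall s v, v \in V s <-> exists c, v = c *m A s.
Proof.
split=> [AV s|AV s]; first by have /basis_rowsP[] := AV s.
by apply/basis_rowsP; rewrite grprod_dim; split=> //; apply: AV.
Qed.

Lemma frame_exists V : exists A, is_frame A V.
Proof.
exists (fun s => \matrix_(a < r s) (vbasis (V s))`_a) => s.
have := vbasisP (V s); rewrite (_ : [seq _ | a <- _] = vbasis (V s)) //.
apply: (@eq_from_nth _ 0) => [|a]; rewrite size_map size_enum_ord.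
  by rewrite size_tuple grprod_dim.
move=> ar; rewrite (nth_map (Ordinal ar)) ?size_enum_ord //.
by rewrite rowK nth_enum_ord.
Qed.

Lemma eq_grprod V V' : (forall s, V s = V' s) -> V = V'.
Proof. by move=> VV'; apply/val_inj/ffunP. Qed.

Lemma frame_inj A V V' : is_frame A V -> is_frame A V' -> V = V'.
Proof.
move=> /frameP AV /frameP AV'; apply: eq_grprod => s; apply/vspaceP=> v.
by apply/idP/idP=> [/AV/AV'|/AV'/AV].
Qed.

Lemma grprod_of_frame A : (forall s, row_free (A s)) -> exists V, is_frame A V.
Proof.
move=> fA; pose V := [ffun s => <<[seq row a (A s) | a <- enum 'I_(r s)]>>%VS].
have dV : [forall s, \dim (V s) == r s].
  apply/forallP=> s; rewrite ffunE.
  by have /basis_rowsP[-> _] := free_rows_basis (fA s).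
by exists (GrProd dV) => s; rewrite /= ffunE; apply: free_rows_basis.
Qed.

(** The fibres of the quotient from frames to points are the orbits of the product of
    the groups GL_(r s). *)
Lemma frame_change A B V : is_frame A V -> is_frame B V ->
  exists2 G : forall s, 'M[F]_(r s), (forall s, G s \in unitmx) &
    B = fun s => G s *m A s.
Proof.
move=> AV BV; have /frameP AV' := AV; have /frameP BV' := BV.
suff H s : exists2 G : 'M[F]_(r s), G \in unitmx & B s = G *m A s.
  exists (fun s => s2val (cid2 (H s))) => [s|]; first by case: cid2.
  by apply: functional_extensionality_dep => s; case: cid2.
have /choice[c cP] : forall a, exists c, row a (B s) = c *m A s.
  by move=> a; apply/AV'/BV'; exists (delta_mx 0 a); rewrite -rowE.
have BG : B s = (\matrix_a c a) *m A s.
  by apply/row_matrixP=> a; rewrite row_mul rowK.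
exists (\matrix_a c a) => //.
have := basis_rows_free (BV s).
rewrite -row_free_unit -!kermx_eq0 BG => /eqP k0.
set G := \matrix_a c a in k0 *.
apply/eqP/row_matrixP=> i; rewrite row0; apply/eqP.
have : (row i (kermx G) <= kermx (G *m A s))%MS.
  by apply/sub_kermxP; rewrite mulmxA -row_mul mulmx_ker row0 mul0mx.
by rewrite k0 submx0.
Qed.

Lemma frame_mul A V (G : forall s, 'M[F]_(r s)) : (forall s, G s \in unitmx) ->
  is_frame A V -> is_frame (fun s => G s *m A s) V.
Proof.
move=> uG /frameP AV; apply/frameP=> s v; split=> [/AV[c ->]|[c ->]].
  by exists (c *m invmx (G s)); rewrite mulmxA mulmxKV.
by apply/AV; exists (c *m G s); rewrite mulmxA.
Qed.

End Frames.

(** * Polynomial maps of frames *)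

Section FrameEval.
Variables (F : fieldType) (I : finType) (r : I -> nat) (N : nat).

(** An induction principle for polynomials: whatever class of functions contains the
    constants and the coordinates of A and is stable under sums and products contains
    p o A. It is applied both to polynomial maps of frames and to polynomial curves. *)
Lemma frame_eval_closed (X : Type) (C : (X -> F) -> Prop) (A : X -> frame F r N)
    (p : frame_poly F r N) :
  (forall c, C (fun=> c)) ->
  (forall f g, C f -> C g -> C (fun x => f x + g x)) ->
  (forall f g, C f -> C g -> C (fun x => f x * g x)) ->
  (forall s a b, C (fun x => A x s a b)) ->
  C (fun x => frame_eval p (A x)).
Proof.
move=> Cc CD CM CA.
rewrite (_ : (fun x => _) = (fun x => \sum_(m <- msupp p) (mcoeff m p * \prod_i
   (A x (tag (enum_val i)) (tagged (enum_val i)).1 (tagged (enum_val i)).2) ^+ m i)));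
  last by apply/funext => x; rewrite /frame_eval mevalE.
elim: (msupp p : seq _) => [|m ms IH].
  by under eq_fun do rewrite big_nil.
under eq_fun do rewrite big_cons.
apply: (CD _ _ _ IH); apply: (CM) => //.
elim: (index_enum _) => [|i s IHs]; first by under eq_fun do rewrite big_nil.
under eq_fun do rewrite big_cons.
apply: (CM _ _ _ IHs); elim: (m i) => [|e IHe].
  by under eq_fun do rewrite expr0.
by under eq_fun do rewrite exprS; apply: CM.
Qed.

Definition polyfun (f : frame F r N -> F) := exists p, forall A, frame_eval p A = f A.

Lemma polyfun_const c : polyfun (fun=> c).
Proof. by exists (mpolyC _ c) => A; rewrite /frame_eval mevalC. Qed.

Lemma polyfunD f g : polyfun f -> polyfun g -> polyfun (fun A => f A + g A).
Proof.
by move=> [p pf] [q qg]; exists (p + q) => A; rewrite -pf -qg /frame_eval mevalD.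
Qed.

Lemma polyfunM f g : polyfun f -> polyfun g -> polyfun (fun A => f A * g A).
Proof.
by move=> [p pf] [q qg]; exists (p * q) => A; rewrite -pf -qg /frame_eval mevalM.
Qed.

Lemma polyfun_entry s a b : polyfun (fun A => A s a b).
Proof.
exists (mpolyX F (mnm1 (enum_rank (Tagged (fun s => ('I_(r s) * 'I_N)%type) (a, b))))).
by move=> A; rewrite /frame_eval mevalXU enum_rankK.
Qed.

Lemma polyfun_sum (J : Type) (s : seq J) (P : pred J) (f : J -> frame F r N -> F) :
  (forall j, polyfun (f j)) -> polyfun (fun A => \sum_(j <- s | P j) f j A).
Proof.
move=> pf; elim: s => [|j s IH].
  by under eq_fun do rewrite big_nil; apply: polyfun_const.
under eq_fun do rewrite big_cons; case: (P j) => //.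
exact: polyfunD.
Qed.

Lemma polyfun_prod (J : Type) (s : seq J) (P : pred J) (f : J -> frame F r N -> F) :
  (forall j, polyfun (f j)) -> polyfun (fun A => \prod_(j <- s | P j) f j A).
Proof.
move=> pf; elim: s => [|j s IH].
  by under eq_fun do rewrite big_nil; apply: polyfun_const.
under eq_fun do rewrite big_cons; case: (P j) => //.
exact: polyfunM.
Qed.

Lemma polyfun_mulmx m1 m2 m3 (X : frame F r N -> 'M[F]_(m1, m2))
    (Y : frame F r N -> 'M[F]_(m2, m3)) :
  (forall a b, polyfun (fun A => X A a b)) ->
  (forall a b, polyfun (fun A => Y A a b)) ->
  forall a b, polyfun (fun A => (X A *m Y A) a b).
Proof.
move=> pX pY a b; under eq_fun do rewrite mxE.
by apply: polyfun_sum => j; apply: polyfunM.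
Qed.

Lemma polyfun_det m (X : frame F r N -> 'M[F]_m) :
  (forall a b, polyfun (fun A => X A a b)) -> polyfun (fun A => \det (X A)).
Proof.
move=> pX; apply: polyfun_sum => s; apply: polyfunM; first exact: polyfun_const.
exact: polyfun_prod.
Qed.

Lemma polyfun_adj m (X : frame F r N -> 'M[F]_m) :
  (forall a b, polyfun (fun A => X A a b)) ->
  forall a b, polyfun (fun A => (\adj (X A)) a b).
Proof.
move=> pX a b; under eq_fun do rewrite mxE /cofactor.
apply: polyfunM; first exact: polyfun_const.
by apply: polyfun_det => a' b'; under eq_fun do rewrite !mxE; apply: pX.
Qed.

End FrameEval.

Lemma polyfun_comp (F : fieldType) (I J : finType) (r : I -> nat) (s : J -> nat)
    (M N : nat) (T : frame F r M -> frame F s N) (f : frame F s N -> F) :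
  (forall j a b, polyfun (fun A => T A j a b)) -> polyfun f ->
  polyfun (fun A => f (T A)).
Proof.
move=> pT [p pf]; under eq_fun do rewrite -pf.
apply: (frame_eval_closed (C := @polyfun F I r M)) => //.
- exact: polyfun_const.
- exact: polyfunD.
- exact: polyfunM.
Qed.

(** Along a polynomial curve of frames, a polynomial function is a polynomial in the
    parameter, hence vanishes only finitely often unless it is zero. *)
Lemma polyfun_polynomial (F : fieldType) (I : finType) (r : I -> nat) (N : nat)
    (A : F -> frame F r N) (f : frame F r N -> F) :
  (forall s a b, exists q : {poly F}, forall t, A t s a b = q.[t]) -> polyfun f ->
  exists q : {poly F}, forall t, f (A t) = q.[t].
Proof.
move=> pA [p pf].
pose C (g : F -> F) := exists q : {poly F}, forall t, g t = q.[t].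
suff [q qP] : C (fun t => frame_eval p (A t)) by exists q => t; rewrite -pf.
apply: (frame_eval_closed (C := C)) => //.
- by move=> c; exists c%:P => t; rewrite hornerC.
- by move=> g h [q1 g1] [q2 h2]; exists (q1 + q2) => t; rewrite hornerD g1 h2.
- by move=> g h [q1 g1] [q2 h2]; exists (q1 * q2) => t; rewrite hornerM g1 h2.
Qed.

Section MorphismOfFrames.
Variables (F : fieldType) (I J : finType) (r : I -> nat) (s : J -> nat) (M N : nat).
Variables (X : set (grprod F r M)) (Y : set (grprod F s N)).
Variables (phi : grprod F r M -> grprod F s N) (T : frame F r M -> frame F s N).
Hypothesis pT : forall j a b, polyfun (fun A => T A j a b).
Hypothesis phiXY : set_fun X Y phi.
Hypothesis phiT : forall A V, X V -> is_frame A V -> is_frame (T A) (phi V).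

(** The preimage of an open set is described by the polynomials p o T only at frames A
    for which T A is a frame. The polynomials p (T (G A)), for all changes of frame G,
    are used together because their common nonvanishing is a condition on the point,
    whatever T does elsewhere. *)
Lemma frame_map_continuous : {within X, continuous phi}.
Proof.
apply/continuousP=> O /open_zariski[S OS].
apply/open_subspaceP.
pose O' := [set V | exists2 A, is_frame A V & exists2 p, S p & frame_eval p (T A) != 0].
exists O'; last first.
  apply/seteqP; split=> [V [[A AV [p Sp pA]] XV]|V [OV XV]]; split=> //.
    by apply/(OS _ _ (phiT XV AV)); exists p.
  have [A AV] := frame_exists V.
  by exists A => //; apply/(OS _ _ (phiT XV AV)).
apply/open_zariski.
exists [set q | exists2 p, S p & exists2 G : forall s, 'M[F]_(r s),
   (forall s, G s \in unitmx) &
   forall A, frame_eval q A = frame_eval p (T (fun s => G s *m A s))].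
move=> A V AV; split=> [[B BV [p Sp pB]]|[q [p Sp [G uG qG]] qA]].
  have [G uG BG] := frame_change AV BV.
  have [q qG] : polyfun (fun A => frame_eval p (T (fun s => G s *m A s))).
    apply: (@polyfun_comp F _ _ _ _ _ _ (fun A : frame F r M => fun s => G s *m A s)
              (fun A => frame_eval p (T A))).
      move=> j; apply: polyfun_mulmx => a b; first exact: polyfun_const.
      exact: polyfun_entry.
    by apply: polyfun_comp => //; exists p.
  by exists q; [exists p => //; exists G | rewrite qG -BG].
exists (fun s => G s *m A s); first exact: frame_mul.
by exists p; rewrite // -qG.
Qed.

Lemma frame_map_morphism : morphism X Y phi.
Proof.
split=> //; first exact: frame_map_continuous.
move=> O f Oo fr A0 V0 [XV0 OV0] A0V0.
have [p [q [q0 pq]]] := fr (T A0) (phi V0) (conj (phiXY XV0) OV0) (phiT XV0 A0V0).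
have [p' pp'] : polyfun (fun A => frame_eval p (T A)).
  by apply: polyfun_comp => //; exists p.
have [q' qq'] : polyfun (fun A => frame_eval q (T A)).
  by apply: polyfun_comp => //; exists q.
exists p', q'; rewrite qq'; split=> // A V [XV OV] AV; rewrite pp' qq' => qA.
by apply: pq => //; [split=> //; apply: phiXY | apply: phiT].
Qed.

End MorphismOfFrames.

(** * Subspaces of prescribed dimension and coordinates *)

(* Coercions leave two spellings of the type of a subspace, which [lia] takes for
   different atoms. *)
Ltac dimlia := unfold reverse_coercion in *; lia.

Section Subspaces.
Variables (F : fieldType) (N : nat).
Local Notation W := 'rV[F]_N.

Lemma dim_add_line (U : {vspace W}) v : v \notin U -> \dim (U + <[v]>) = (\dim U).+1.
Proof.
move=> vU; rewrite dimv_disjoint_sum ?dim_vline; last first.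
  apply/eqP; rewrite -subv0; apply/subvP=> u /memv_capP[uU /vlineP[k ku]].
  have [k0|k0] := eqVneq k 0; first by rewrite ku k0 scale0r mem0v.
  by move: vU; rewrite -(scalerK k0 v) -ku memvZ.
case: eqP => [v0|_]; last by rewrite addn1.
by move: vU; rewrite v0 mem0v.
Qed.

Lemma subv_dim_intermediate (A B : {vspace W}) (i : nat) :
  (A <= B)%VS -> (\dim A <= i <= \dim B)%N ->
  exists C, [/\ (A <= C)%VS, (C <= B)%VS & \dim C = i].
Proof.
move=> AB /andP[]; move e: (i - \dim A)%N => e'.
elim: e' A e AB => [|e IH] A iA AB Ai iB.
  by exists A; split=> //; lia.
have /subvPn[v vB vA] : ~~ (B <= A)%VS.
  by apply/negP=> /dimvS; lia.
have dA := dim_add_line vA.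
case: (IH (A + <[v]>)%VS); rewrite ?dA //; try lia.
  by rewrite subv_add AB; apply/subvP=> u /vlineP[k ->]; apply: memvZ.
move=> C [AC CB dC]; exists C; split=> //.
by apply: subv_trans AC; apply: addvSl.
Qed.

Lemma choice_subv_dim : exists ext : {vspace W} -> {vspace W} -> nat -> {vspace W},
  forall A B i, (A <= B)%VS -> (\dim A <= i <= \dim B)%N ->
  [/\ (A <= ext A B i)%VS, (ext A B i <= B)%VS & \dim (ext A B i) = i].
Proof.
have /choice[f fP] : forall p : {vspace W} * {vspace W} * nat, exists C,
    (p.1.1 <= p.1.2)%VS -> (\dim p.1.1 <= p.2 <= \dim p.1.2)%N ->
    [/\ (p.1.1 <= C)%VS, (C <= p.1.2)%VS & \dim C = p.2].
  move=> [[A B] i] /=.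
  have [AB|nAB] := boolP (A <= B)%VS; last by exists A.
  have [Ai|nAi] := boolP (\dim A <= i <= \dim B)%N; last by exists A.
  by have [C CP] := subv_dim_intermediate AB Ai; exists C.
by exists (fun A B i => f (A, B, i)) => A B i; apply: (fP (A, B, i)).
Qed.

Lemma mem_lker_mul m (M : 'M[F]_(N, m)) (v : W) :
  (v \in lker (linfun (mulmxr M))) = (v *m M == 0).
Proof. by rewrite memv_ker lfunE. Qed.

(** The equations v *m M = 0 are m linear conditions. *)
Lemma dim_cap_lker m (M : 'M[F]_(N, m)) (U : {vspace W}) :
  (\dim U <= \dim (U :&: lker (linfun (mulmxr M))) + m)%N.
Proof.
rewrite -(limg_ker_dim (linfun (mulmxr M)) U) leq_add2l.
by apply: leq_trans (dimvS (subvf _)) _; rewrite dimvf dim_matrix mul1r.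
Qed.

Lemma mulmx_delta_col (v : W) c : (v *m delta_mx c (0 : 'I_1) == 0) = (v 0 c == 0).
Proof.
rewrite -colE; apply/eqP/eqP => [/colP/(_ 0)|v0]; first by rewrite !mxE.
by apply/colP=> a; rewrite !mxE ord1.
Qed.

End Subspaces.

Section Coordinates.
Variables (F : fieldType) (n : nat).
Local Notation W := 'rV[F]_(2 * n).

Lemma prE k (v : W) c : (pr F n k v) 0 c = if c.+1 == k then 0 else v 0 c.
Proof. by rewrite lfunE /= mxE. Qed.

Lemma prs_id a b : (b < a)%N -> prs F n a b = \1%VF.
Proof. by move=> ba; rewrite /prs big_geq. Qed.

Lemma prsE a b (v : W) c :
  (prs F n a b v) 0 c = if (a <= c.+1 <= b)%N then 0 else v 0 c.
Proof.
move m: (b.+1 - a)%N => m'; elim: m' a m => [|m IH] a ab.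
  rewrite prs_id ?id_lfunE; last by lia.
  by case: ifP => //; lia.
rewrite /prs big_ltn ?comp_lfunE ?prE; last by lia.
rewrite IH; last by lia.
by have [ca|ca] := eqVneq c.+1 a; do ?[case: ifP => ?] => //; lia.
Qed.

Lemma prsSr a b : (a <= b.+1)%N -> prs F n a b.+1 = (pr F n b.+1 \o prs F n a b)%VF.
Proof.
move=> ab; apply/lfunP=> v; rewrite comp_lfunE; apply/rowP=> c.
by rewrite prE !prsE; have [cb|cb] := eqVneq c.+1 b.+1; do ?[case: ifP => ?] => //; lia.
Qed.

Lemma prs_prs a b c (v : W) : (a <= b.+1)%N -> (b <= c)%N ->
  prs F n b.+1 c (prs F n a b v) = prs F n a c v.
Proof.
move=> ab bc; apply/rowP=> x; rewrite !prsE.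
by do ?[case: ifP => ?] => //; lia.
Qed.

Lemma pr_decomp k (v : W) : exists b, v = pr F n k v + b *: w F n k.
Proof.
have [[c ck]|nk] := pselect (exists c : 'I_(2 * n), c.+1 = k).
  exists (v 0 c); apply/rowP => c'; rewrite !mxE prE.
  case: eqP => [c'k|_]; last by rewrite mulr0 addr0.
  by rewrite mulr1 add0r; congr (v 0 _); apply/val_inj => /=; lia.
exists 0; rewrite scale0r addr0; apply/rowP => c; rewrite prE.
by case: eqP => // ck; case: nk; exists c.
Qed.

Lemma WsubP i j (v : W) :
  v \in Wsub F n i j <-> forall c : 'I_(2 * n), (i <= c < j)%N -> v 0 c = 0.
Proof.
split=> [vW c ic|v0].
  apply/eqP; rewrite -mulmx_delta_col -mem_lker_mul; apply: subvP v vW.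
  apply/span_subvP=> u /mapP[a aij ->]; rewrite mem_lker_mul mulmx_delta_col mxE.
  have [ca|_] := eqVneq c.+1 a; last by [].
  by exfalso; move: aij; rewrite mem_cat !mem_index_iota; lia.
rewrite [v]row_sum_delta; apply: memv_suml => c _.
have [ic|ic] := boolP (i <= c < j)%N; first by rewrite v0 // scale0r mem0v.
apply/memvZ/memv_span/mapP; exists c.+1.
  by rewrite mem_cat !mem_index_iota; have := ltn_ord c; lia.
by apply/rowP=> c'; rewrite !mxE eqxx eqSS.
Qed.

Lemma dim_Wsub i j : (i <= j)%N -> (2 * n + i <= \dim (Wsub F n i j) + j)%N.
Proof.
move=> ij; pose M : 'M[F]_(2 * n, j - i) := \matrix_(c, b) (c == i + b :> nat)%N%:R.
have := dim_cap_lker M {:W}; rewrite capfv dimvf dim_matrix mul1r => dW.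
suff /dimvS dK : (lker (linfun (mulmxr M)) <= Wsub F n i j)%VS by dimlia.
apply/subvP=> v; rewrite mem_lker_mul => /eqP vM; apply/WsubP=> c ic.
have cij : (c - i < j - i)%N by lia.
have /rowP/(_ (Ordinal cij)) := vM; rewrite !mxE (bigD1 c) //= big1.
  by rewrite !mxE addr0 /= (_ : (c == i + (c - i) :> nat)%N) ?mulr1 //; lia.
move=> c' c'c; rewrite mxE /=; case: eqP => [c'i|]; last by rewrite mulr0.
by case/eqP: c'c; apply/val_inj => /=; lia.
Qed.

(** For i < j, W_{i,j} is the hyperplane of W_{i+1,j} on which the coordinate of w_{i+1}
    vanishes. *)
Lemma dim_cap_Wsub i j (U : {vspace W}) : (U <= Wsub F n i.+1 j)%VS ->
  (\dim U <= (\dim (U :&: Wsub F n i j)).+1)%N.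
Proof.
move=> UW; have [i2n|i2n] := ltnP i (2 * n); last first.
  suff -> : (U :&: Wsub F n i j)%VS = U by apply: leqnSn.
  apply/capv_idPl/(subv_trans UW)/subvP => v _; apply/WsubP => c; have := ltn_ord c; lia.
have := dim_cap_lker (delta_mx (Ordinal i2n) (0 : 'I_1)) U.
rewrite addn1 => /leq_trans; apply; rewrite ltnS; apply/dimvS/subvP=> v.
rewrite !memv_cap mem_lker_mul mulmx_delta_col => /andP[vU /eqP v0]; rewrite vU.
apply/WsubP => c ic; have [ci|ci] := eqVneq (c : nat) i.
  by rewrite -[RHS]v0; congr (v _ _); apply/val_inj.
by have /WsubP := subvP UW _ vU; apply; lia.
Qed.

Lemma img_prs_sub a b (U V : {vspace W}) :
  (forall v, v \in U -> prs F n a b v \in V) -> (prs F n a b @: U <= V)%VS.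
Proof. by move=> UV; apply/subvP=> _ /memv_imgP[v vU ->]; apply: UV. Qed.

End Coordinates.

(** * The symplectic form *)

Section Symplectic.
Variables (n : nat).

(** The matrix of the form over any ring: it is used over F and over {poly F}. *)
Definition gram (R : pzRingType) : 'M[R]_(2 * n) :=
  \matrix_(i, j) ((-1) ^+ (n <= i)%N * (j == rev_ord i)%:R).

Lemma mul_gram (R : pzRingType) m (A : 'M[R]_(m, 2 * n)) a c :
  (A *m gram R) a c = (-1) ^+ (c < n)%N * A a (rev_ord c).
Proof.
rewrite mxE (bigD1 (rev_ord c)) //= big1 => [|b bc]; last first.
  rewrite mxE (_ : (c == rev_ord b) = false) ?mulr0 //.
  by apply: contra_neqF bc => /eqP->; rewrite rev_ordK.
rewrite mxE rev_ordK eqxx mulr1 addr0 (_ : (n <= rev_ord c)%N = (c < n)%N); last first.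
  by have := ltn_ord c; rewrite /=; lia.
by rewrite -signr_odd; case: odd; rewrite ?expr1 ?mulrN1 ?mulN1r ?expr0 ?mulr1 ?mul1r.
Qed.

Lemma gram_mul (R : pzRingType) m (A : 'M[R]_(2 * n, m)) a c :
  (gram R *m A) a c = (-1) ^+ (n <= a)%N * A (rev_ord a) c.
Proof.
rewrite mxE (bigD1 (rev_ord a)) //= big1 => [|b bc]; last first.
  by rewrite mxE (negbTE bc) mulr0 mul0r.
by rewrite mxE eqxx mulr1 addr0.
Qed.

Lemma gram_sqr (R : pzRingType) : gram R *m gram R = - 1%:M.
Proof.
apply/matrixP=> a c; rewrite mul_gram !mxE (inj_eq rev_ord_inj) eq_sym mulrA.
have [->|_] := eqVneq a c; last by rewrite mulr0 oppr0.
by rewrite ltnNge; case: leq; rewrite ?expr0 ?expr1 ?mul1r ?mulr1.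
Qed.

End Symplectic.

Section SymplecticForm.
Variables (F : numFieldType) (n : nat).
Local Notation W := 'rV[F]_(2 * n).

Lemma omegaE (u v : W) : omega u v = (u *m gram n F *m v^T) 0 0.
Proof.
rewrite mxE /omega (reindex_inj rev_ord_inj) /=; apply: eq_bigr => c _.
rewrite mul_gram rev_ordK mxE; congr (_ ^+ nat_of_bool _ * _ * _).
by have := ltn_ord c; rewrite /=; lia.
Qed.

Lemma omega_self (v : W) : omega v v = 0.
Proof.
have /eqP := omegaC v v; rewrite -addr_eq0 -mulr2n -mulr_natl mulf_eq0.
by rewrite Num.Theory.pnatr_eq0 /= => /eqP.
Qed.

Lemma omegaDl (u u' v : W) : omega (u + u') v = omega u v + omega u' v.
Proof. by rewrite !omegaE !mulmxDl mxE. Qed.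

Lemma omegaZl a (u v : W) : omega (a *: u) v = a * omega u v.
Proof. by rewrite !omegaE -!scalemxAl mxE. Qed.

Lemma omegaDr (u v v' : W) : omega u (v + v') = omega u v + omega u v'.
Proof. by rewrite omegaC omegaDl opprD -!omegaC. Qed.

Lemma omegaZr a (u v : W) : omega u (a *: v) = a * omega u v.
Proof. by rewrite omegaC omegaZl -mulrN -omegaC. Qed.

Lemma isotropicS (U V : {vspace W}) : (U <= V)%VS -> isotropic V -> isotropic U.
Proof. by move=> /subvP UV iV u v /UV uV /UV; apply: iV. Qed.

(** Omitting basis vectors does not change the form between u and v as long as the
    partners w_{2n+1-m} of the omitted vectors w_m do not occur in u and v. This is why
    isotropy passes along the maps of the degenerate flag. *)
Lemma omega_prs a b (u v : W) :
  (forall c : 'I_(2 * n), (a <= c.+1 <= b)%N ->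
     u 0 (rev_ord c) = 0 /\ v 0 (rev_ord c) = 0) ->
  omega (prs F n a b u) (prs F n a b v) = omega u v.
Proof.
move=> uv0; apply: eq_bigr => c _; rewrite !prsE.
have [/uv0[_ ->]|_] := boolP (a <= c.+1 <= b)%N; first by case: ifP; rewrite !mulr0.
case: ifP => // /uv0; rewrite rev_ordK => -[-> _].
by rewrite !mulr0 ?mul0r.
Qed.

(** As long as A has dimension less than i, the orthogonal of A in the 2i-dimensional
    W_{i,2n-i} has dimension at least 2i - dim A, which exceeds dim A, so a vector
    outside A but orthogonal to it can be added. *)
Lemma lagrangian_extension i (A : {vspace W}) : (i <= n)%N ->
  isotropic A -> (A <= Wsub F n i (2 * n - i))%VS -> (\dim A <= i)%N ->
  exists B, [/\ (A <= B)%VS, (B <= Wsub F n i (2 * n - i))%VS, \dim B = i & isotropic B].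
Proof.
move=> ni; move e: (i - \dim A)%N => e'.
elim: e' A e => [|e IH] A iA isoA AW Ai; first by exists A; split=> //; lia.
pose M : 'M[F]_(\dim A, 2 * n) := \matrix_a (vbasis A)`_a.
pose A' : {vspace W} := lker (linfun (mulmxr (gram n F *m M^T))).
have A'P (u v : W) : u \in A' -> v \in A -> omega u v = 0.
  rewrite mem_lker_mul => /eqP uM vA.
  rewrite (coord_vbasis vA) omegaE linear_sum mulmx_sumr summxE big1 // => a _.
  rewrite linearZ -scalemxAr mxE (_ : (_ *m _ *m _) 0 0 = 0) ?mulr0 //.
  by have /rowP/(_ a) := uM; rewrite mulmxA !mxE => uM'; rewrite -[RHS]uM';
    apply: eq_bigr => c _; rewrite !mxE.
have dA' := dim_cap_lker (gram n F *m M^T) (Wsub F n i (2 * n - i)).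
have dW : (2 * n + i <= \dim (Wsub F n i (2 * n - i)) + (2 * n - i))%N.
  by apply: dim_Wsub; lia.
have /subvPn[v] : ~~ (Wsub F n i (2 * n - i) :&: A' <= A)%VS.
  apply/negP=> /dimvS dK.
  have : (2 * n + i <= \dim A + \dim A + (2 * n - i))%N.
    apply: leq_trans dW _; rewrite leq_add2r; apply: leq_trans dA' _.
    by rewrite leq_add2r.
  by dimlia.
rewrite memv_cap => /andP[vW vA'] vA.
have dA := dim_add_line vA.
case: (IH (A + <[v]>)%VS).
- by rewrite dA subnS iA.
- move=> _ _ /memv_addP[u uA [_ /vlineP[k ->] ->]] /memv_addP[u' u'A [_ /vlineP[k' ->] ->]].
  rewrite !omegaDl !omegaDr !omegaZl !omegaZr isoA // omega_self.
  by rewrite (omegaC u v) !A'P // oppr0 !mulr0 !addr0.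
- by rewrite subv_add AW; apply/subvP=> u /vlineP[k ->]; apply: memvZ.
- by rewrite dA -subn_gt0 iA.
move=> B [AB BW dB iB]; exists B; split=> //.
by apply: subv_trans AB; apply: addvSl.
Qed.

End SymplecticForm.

(** * Completing a symplectic degenerate flag *)

Section FullFlag.
Variables (F : numFieldType) (n k : nat) (d : 'I_k -> nat).
Hypothesis d_range : forall l, (1 <= d l <= n)%N.
Hypothesis d_incr : forall l m : 'I_k, (l < m)%N -> (d l < d m)%N.
Local Notation W := 'rV[F]_(2 * n).
Variable V : grprod F d (2 * n).
Hypothesis VF : SpF F n d V.

Lemma d_homo (l m : 'I_k) : (l <= m)%N -> (d l <= d m)%N.
Proof.
by rewrite leq_eqVlt => /orP[/eqP/val_inj->|/d_incr/ltnW].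
Qed.

(** The defining conditions concern consecutive indices; they compose. *)
Lemma SpF_prs (l m : 'I_k) : (l <= m)%N -> (prs F n (d l).+1 (d m) @: V l <= V m)%VS.
Proof.
move: m => [m mk] /=; elim: m mk => [|m IH] mk lm.
  have -> : Ordinal mk = l by apply/val_inj => /=; lia.
  by rewrite prs_id // lim1g.
have [lm'|] := ltnP m l.
  have -> : Ordinal mk = l by apply/val_inj => /=; lia.
  by rewrite prs_id // lim1g.
move=> lm'; have mk' : (m < k)%N by apply: ltnW.
apply/img_prs_sub=> v vV.
rewrite -(@prs_prs F n (d l).+1 (d (Ordinal mk'))).
- have [_ /(_ (Ordinal mk') (Ordinal mk) erefl)/subvP] := VF; apply.
  by apply/memv_img/(subvP (IH mk' lm'))/memv_img.
- by rewrite ltnS; apply: d_homo.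
- by apply: d_homo => /=.
Qed.

(** The vectors w_{i+1}, ..., w_n are the partners of w_{n+1}, ..., w_{2n-i}, so that once
    the former are omitted, omitting the latter does not affect the form. *)
Lemma isotropic_prs_half i (U : {vspace W}) : (i <= n)%N ->
  isotropic (prs F n i.+1 (2 * n - i) @: U) -> isotropic (prs F n i.+1 n @: U).
Proof.
move=> ni isoU _ _ /memv_imgP[u uU ->] /memv_imgP[v vU ->].
rewrite -(@omega_prs F n n.+1 (2 * n - i)) => [|c cn]; last first.
  by rewrite !prsE !ifT //= ; lia.
by rewrite !prs_prs; [apply: isoU; apply: memv_img | lia..].
Qed.

(** The part of W that any space completing the flag in dimension i must contain. *)
Definition flag_lower i : {vspace W} :=
  (\sum_(l < k | (d l <= i)%N) prs F n (d l).+1 i @: V l)%VS.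

(** The conditions between different V_l make the summands increase with l, so the sum is
    its last term; this gives both the dimension bound and isotropy. *)
Lemma flag_lower_eq i : flag_lower i = 0%VS \/
  exists2 m, (d m <= i)%N & (flag_lower i <= prs F n (d m).+1 i @: V m)%VS.
Proof.
have [[l li]|nl] := pselect (exists l, (d l <= i)%N); last first.
  by left; rewrite /flag_lower big1 // => l li; case: nl; exists l.
right; case: (@arg_maxnP _ l (fun l => d l <= i)%N (fun l => l : nat) li) => m mi mmax.
exists m => //; apply/subv_sumP => l' l'i; apply/img_prs_sub => v vV.
have lm := mmax _ l'i.
rewrite -(@prs_prs F n (d l').+1 (d m)) // ?ltnS ?d_homo //.
by apply/memv_img/(subvP (SpF_prs lm))/memv_img.
Qed.

Lemma dim_img_prs a b (U : {vspace W}) : (\dim (prs F n a b @: U) <= \dim U)%N.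
Proof. by rewrite -(limg_ker_dim (prs F n a b) U) leq_addl. Qed.

Lemma flag_lower_dim i : (\dim (flag_lower i) <= i)%N.
Proof.
have [->|[m mi /dimvS dm]] := flag_lower_eq i; first by rewrite dimv0.
apply: leq_trans dm _; apply: leq_trans (dim_img_prs _ _ _) _.
by rewrite grprod_dim.
Qed.

Lemma flag_lower_isotropic : isotropic (flag_lower n).
Proof.
have [->|[m mi /isotropicS]] := flag_lower_eq n.
  move=> u v; rewrite !memv0 => /eqP-> /eqP->; exact: omega_self.
apply; apply: isotropic_prs_half => //; exact: (VF.1 m).
Qed.

Lemma flag_lower_pr i : (pr F n i.+1 @: flag_lower i <= flag_lower i.+1)%VS.
Proof.
rewrite limg_sum; apply/subv_sumP => l li; rewrite -limg_comp -prsSr; last by lia.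
by apply: (sumv_sup l) => //; lia.
Qed.

Lemma flag_lower_sup l : (V l <= flag_lower (d l))%VS.
Proof. by apply: (sumv_sup l) => //; rewrite prs_id // lim1g. Qed.

(** Every degenerate flag can be refined to a full one C_1, ..., C_n with C_n Lagrangian.
    The top space is a Lagrangian subspace containing flag_lower n; going down, C_i is
    chosen of dimension i between flag_lower i and the preimage of C_{i+1} under
    pr_{i+1}. At i = d_l there is no choice left, since flag_lower (d_l) contains V_l,
    which already has that dimension. *)
Lemma full_flag : exists C : nat -> {vspace W},
  [/\ forall i, (i <= n)%N -> \dim (C i) = i,
      forall i, (i < n)%N -> (pr F n i.+1 @: C i <= C i.+1)%VS,
      isotropic (C n) & forall l, C (d l) = V l].
Proof.
have [E [LE _ dE isoE]] : exists B, [/\ (flag_lower n <= B)%VS,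
    (B <= Wsub F n n (2 * n - n))%VS, \dim B = n & isotropic B].
  apply: lagrangian_extension => //; first exact: flag_lower_isotropic.
    by apply/subvP=> v _; apply/WsubP => c; lia.
  exact: flag_lower_dim.
have [ext extP] := choice_subv_dim F (2 * n).
pose D := fix D m := if m is m'.+1 then
  ext (flag_lower (n - m)) (pr F n (n - m') @^-1: D m')%VS (n - m)%N else E.
have DP m : (m < n)%N -> (flag_lower (n - m) <= D m)%VS -> \dim (D m) = (n - m)%N ->
    [/\ (flag_lower (n - m.+1) <= D m.+1)%VS,
        (pr F n (n - m) @: D m.+1 <= D m)%VS & \dim (D m.+1) = (n - m.+1)%N].
  move=> mn LD dD; have nm : (n - m)%N = (n - m.+1).+1 by lia.
  have i2n : (n - m.+1 < 2 * n)%N by lia.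
  case: (extP (flag_lower (n - m.+1)) (pr F n (n - m) @^-1: D m)%VS (n - m.+1)%N).
  - apply/subvP=> v vL; rewrite -memv_preim; apply: (subvP LD); rewrite nm.
    by apply: (subvP (flag_lower_pr _)); apply: memv_img.
  - rewrite flag_lower_dim /=.
    have := dim_cap_lker (delta_mx (Ordinal i2n) (0 : 'I_1)) (D m).
    rewrite dD {1}nm addn1 ltnS => /leq_trans; apply; apply/dimvS/subvP=> v.
    rewrite memv_cap mem_lker_mul mulmx_delta_col -memv_preim => /andP[vD /eqP v0].
    suff -> : pr F n (n - m) v = v by [].
    apply/rowP=> c; rewrite prE; case: eqP => // cm.
    by rewrite -v0; congr (v _ _); apply/val_inj => /=; lia.
  move=> LD1 D1p dD1; split=> //.
  by apply/subvP=> _ /memv_imgP[v vD ->]; rewrite memv_preim; apply: (subvP D1p).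
have DP' m : (m <= n)%N -> (flag_lower (n - m) <= D m)%VS /\ \dim (D m) = (n - m)%N.
  elim: m => [|m IH] mn; first by rewrite subn0.
  by have [LD dD] := IH (ltnW mn); have [] := DP m mn LD dD.
exists (fun i => D (n - i)%N).
have dC i : (i <= n)%N -> \dim (D (n - i)%N) = i.
  by move=> ni; have [_ ->] := DP' (n - i)%N (leq_subr _ _); lia.
split=> //; last 2 first.
- by rewrite subnn.
- move=> l; have /andP[_ dn] := d_range l; apply/esym/eqP.
  rewrite eqEdim dC // grprod_dim leqnn andbT.
  apply: subv_trans (flag_lower_sup l) _.
  by have [+ _] := DP' (n - d l)%N (leq_subr _ _); rewrite subKn.
move=> i ni; have mn : (n - i.+1 < n)%N by lia.
have [LD dD] := DP' _ (ltnW mn); have [_ + _] := DP _ mn LD dD.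
by rewrite subKn // (_ : (n - i.+1).+1 = (n - i)%N) //; lia.
Qed.

End FullFlag.

(** * Filling the triangle of positions below a full flag *)

Section Filling.
Variables (F : numFieldType) (n : nat).
Local Notation W := 'rV[F]_(2 * n).

Lemma pr_img_Wsub i j (U : {vspace W}) : (U <= Wsub F n i j)%VS ->
  (pr F n j.+1 @: U <= Wsub F n i j.+1)%VS.
Proof.
move=> /subvP UW; apply/subvP=> _ /memv_imgP[v /UW/WsubP v0 ->].
apply/WsubP=> c ic; rewrite prE; case: eqP => // cj; apply: v0; lia.
Qed.

(** The vector w_{j+1} that is omitted has w_{i+1} as partner, and W_{i,j} does not involve
    w_{i+1}. *)
Lemma pr_img_isotropic i j (U : {vspace W}) : (i + j).+1 = (2 * n)%N -> (i < j)%N ->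
  isotropic U -> (U <= Wsub F n i j)%VS -> isotropic (pr F n j.+1 @: U).
Proof.
move=> ij lij isoU /subvP UW _ _ /memv_imgP[u uU ->] /memv_imgP[v vU ->].
have prs1 : pr F n j.+1 = prs F n j.+1 j.+1.
  apply/lfunP=> v'; apply/rowP=> c.
  by rewrite prE prsE; congr (if _ then _ else _); lia.
rewrite prs1 omega_prs => [|c cj]; first exact: isoU.
by have /WsubP u0 := UW _ uU; have /WsubP v0 := UW _ vU; split;
  [apply: u0 | apply: v0]; rewrite /=; lia.
Qed.

(** The spaces Z i j are chosen by increasing j - i. Inside the triangle, Z i j has to lie
    between pr_j (Z i (j-1)) and the intersection of Z (i+1) j with W_{i,j}; the first has
    dimension at most i, the second at least i, and the inclusion follows from the square
    through position (i+1, j-1), or from the hypothesis on C when j = i+1. On the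
    antidiagonal there is no upper bound but the image of Z i (j-1) is isotropic, and a
    Lagrangian extension is chosen. *)
Lemma fill_triangle (C : nat -> {vspace W}) :
  (forall i, (i <= n)%N -> \dim (C i) = i) ->
  (forall i, (i < n)%N -> (pr F n i.+1 @: C i <= C i.+1)%VS) ->
  isotropic (C n) ->
  exists Z : nat -> nat -> {vspace W},
  [/\ forall i, (i <= n)%N -> Z i i = C i,
      forall i j, (i <= j)%N -> (i + j <= 2 * n)%N ->
        \dim (Z i j) = i /\ (Z i j <= Wsub F n i j)%VS,
      forall i j, (i < j)%N -> (i.+1 + j <= 2 * n)%N -> (Z i j <= Z i.+1 j)%VS,
      forall i j, (i <= j)%N -> (i + j.+1 <= 2 * n)%N ->
        (pr F n j.+1 @: Z i j <= Z i j.+1)%VS &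
      forall i j, (i <= j)%N -> (i + j = 2 * n)%N -> isotropic (Z i j)].
Proof.
move=> dC prC isoC.
have [ext extP] := choice_subv_dim F (2 * n).
have /choice[lag lagP] : forall p : {vspace W} * nat, exists B, (p.2 <= n)%N ->
    isotropic p.1 -> (p.1 <= Wsub F n p.2 (2 * n - p.2))%VS -> (\dim p.1 <= p.2)%N ->
    [/\ (p.1 <= B)%VS, (B <= Wsub F n p.2 (2 * n - p.2))%VS, \dim B = p.2 & isotropic B].
  move=> [A i] /=.
  have [H|H] := pselect [/\ (i <= n)%N, isotropic A,
      (A <= Wsub F n i (2 * n - i))%VS & (\dim A <= i)%N]; last first.
    by exists A => *; case: H.
  by case: H => h1 h2 h3 h4; have [B BP] := lagrangian_extension h1 h2 h3 h4; exists B.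
(* [Z m i] is the space in position (i, i + m). *)
pose Z := fix Z m i : {vspace W} := if m is m'.+1 then
    let A := (pr F n (i + m) @: Z m' i)%VS in
    if (2 * i + m == 2 * n)%N then lag (A, i)
    else ext A (Z m' i.+1 :&: Wsub F n i (i + m))%VS i
  else C i.
pose inv m i := [/\ \dim (Z m i) = i, (Z m i <= Wsub F n i (i + m))%VS &
   (2 * i + m == 2 * n)%N -> isotropic (Z m i)].
pose next m i := ((2 * i + m.+1 = 2 * n)%N -> isotropic (pr F n (i + m).+1 @: Z m i)) /\
   ((2 * i + m.+1 < 2 * n)%N -> (pr F n (i + m).+1 @: Z m i <= Z m i.+1)%VS).
have step m i : (2 * i + m.+1 <= 2 * n)%N -> inv m i ->
    ((2 * i + m.+1 < 2 * n)%N -> inv m i.+1) -> next m i ->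
    [/\ inv m.+1 i, (pr F n (i + m).+1 @: Z m i <= Z m.+1 i)%VS &
        (2 * i + m.+1 < 2 * n)%N -> (Z m.+1 i <= Z m i.+1)%VS].
  move=> im [dZ ZW isoZ] invS [next_iso next_sub].
  have dA : (\dim (pr F n (i + m).+1 @: Z m i) <= i)%N.
    by rewrite -[leqRHS]dZ -(limg_ker_dim (pr F n (i + m).+1) (Z m i)) leq_addl.
  have AW := pr_img_Wsub ZW.
  rewrite /inv /=; case: eqP => [ime|/eqP ime]; rewrite !addnS.
    case: (lagP (pr F n (i + m).+1 @: Z m i, i)%VS) => //=; first by lia.
    - exact: next_iso.
    - by rewrite (_ : (2 * n - i)%N = (i + m).+1) //; lia.
    by rewrite (_ : (2 * n - i)%N = (i + m).+1); [split=> //; lia|lia].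
  have im' : (2 * i + m.+1 < 2 * n)%N by lia.
  have [dS SW _] := invS im'.
  rewrite addSn in SW.
  case: (extP (pr F n (i + m).+1 @: Z m i)%VS (Z m i.+1 :&: Wsub F n i (i + m).+1)%VS i).
  - by rewrite subv_cap AW next_sub.
  - by rewrite dA /=; have := dim_cap_Wsub SW; rewrite dS.
  by rewrite subv_cap => AB /andP[BZ BW] dB.
have all m : (forall i, (2 * i + m <= 2 * n)%N -> inv m i) /\
             (forall i, (2 * i + m.+1 <= 2 * n)%N -> next m i).
  elim: m => [|m [IHi IHn]].
    split=> i im; split=> /=; rewrite ?addn0.
    - by apply: dC; lia.
    - by apply/subvP=> v _; apply/WsubP=> c; lia.
    - by move=> /eqP im'; rewrite (_ : i = n) //; lia.
    - by lia.
    - by move=> im'; apply: prC; lia.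
  have stepm i : (2 * i + m.+1 <= 2 * n)%N ->
      [/\ inv m.+1 i, (pr F n (i + m).+1 @: Z m i <= Z m.+1 i)%VS &
          (2 * i + m.+1 < 2 * n)%N -> (Z m.+1 i <= Z m i.+1)%VS].
    move=> im; apply: step => // [|im'|]; [apply: IHi; lia|apply: IHi; lia|exact: IHn].
  split=> i im; first by have [] := stepm i im.
  have im' : (2 * i + m.+1 < 2 * n)%N by lia.
  have [[dZ ZW _] _ /(_ im') ZZ] := stepm i (ltnW im').
  split=> im2.
    have [|_ _ isoS] := IHi i.+1; first by lia.
    apply: (@pr_img_isotropic i) => //; try lia.
    by apply: isotropicS ZZ _; apply: isoS; lia.
  have [|_ prS _] := stepm i.+1; first by lia.
  rewrite (_ : (i + m.+1).+1 = (i.+1 + m).+1); last by lia.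
  by apply: subv_trans prS; apply: limgS.
exists (fun i j => Z (j - i)%N i); split.
- by move=> i ni; rewrite subnn.
- move=> i j ij ijn; have [+ _] := all (j - i)%N => /(_ i) [|]; first by lia.
  by rewrite subnKC.
- move=> i j ij ijn; have [invj nextj] := all (j - i.+1)%N.
  rewrite (_ : (j - i)%N = (j - i.+1).+1); last by lia.
  case: (step (j - i.+1)%N i).
  - by lia.
  - by apply: invj; lia.
  - by move=> _; apply: invj; lia.
  - by apply: nextj; lia.
  - by move=> _ _; apply; lia.
- move=> i j ij ijn; have [invj nextj] := all (j - i)%N.
  rewrite subSn //; case: (step (j - i)%N i).
  - by lia.
  - by apply: invj; lia.
  - by move=> ijn2; apply: invj; lia.
  - by apply: nextj; lia.
  - by rewrite subnKC // => _.
- move=> i j ij ijn; have [+ _] := all (j - i)%N => /(_ i) [|_ _]; first by lia.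
  by apply; lia.
Qed.

End Filling.

Section Surjectivity.
Variables (F : numFieldType) (n k : nat) (d : 'I_k -> nat).
Hypothesis d_range : forall l, (1 <= d l <= n)%N.
Hypothesis d_incr : forall l m : 'I_k, (l < m)%N -> (d l < d m)%N.

Lemma in_PP (p : P_d n d) : [/\ (1 <= fst_P p)%N, (fst_P p <= snd_P p)%N,
  (fst_P p + snd_P p <= 2 * n)%N & exists l, (fst_P p <= d l <= snd_P p)%N].
Proof. by have /and4P[h1 h2 h3 /existsP[l h4]] := valP p; split=> //; exists l. Qed.

(** Refine the degenerate flag to a full one, fill the whole triangle below it, and keep
    the positions in P_d. *)
Theorem diag_map_surj V : SpF F n d V ->
  exists2 x, SpR F n d x & diag_map d_range x = V.
Proof.
move=> VF; have [C [dC prC isoC CV]] := full_flag d_range d_incr VF.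
have [Z [ZC Zdim Zsub Zpr Ziso]] := fill_triangle dC prC isoC.
pose x := [ffun p : P_d n d => Z (fst_P p) (snd_P p)].
have dx : [forall p, \dim (x p) == fst_P p].
  apply/forallP=> p; rewrite ffunE; have [_ h1 h2 _] := in_PP p.
  by have [->] := Zdim _ _ h1 h2.
exists (GrProd dx); last first.
  apply: eq_grprod => l; rewrite /= !ffunE ZC ?CV //.
  by have /andP[] := d_range l.
split=> /= [p|p q pq1 pq2|p q pq1 pq2|p pn].
- by rewrite ffunE; have [_ h1 h2 _] := in_PP p; have [] := Zdim _ _ h1 h2.
- rewrite !ffunE pq1 pq2; have [_ h1 h2 _] := in_PP q.
  by apply: Zsub; rewrite -?pq1 -?pq2.
- rewrite !ffunE pq1 pq2; have [_ h1 h2 _] := in_PP q; have [_ h3 h4 _] := in_PP p.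
  by apply: Zpr; rewrite // -pq1 -pq2.
- by rewrite ffunE; apply: Ziso => //; have [] := in_PP p.
Qed.

End Surjectivity.

(** * Entries of a point of the resolution *)

Section Triangle.
Variables (F : fieldType) (n k : nat) (d : 'I_k -> nat).
Hypothesis d_range : forall l, (1 <= d l <= n)%N.
Local Notation W := 'rV[F]_(2 * n).
Implicit Types (x : grprod F (@fst_P n k d) (2 * n)).

Lemma P_d_inj (p q : P_d n d) : fst_P p = fst_P q -> snd_P p = snd_P q -> p = q.
Proof.
move=> pq1 pq2; apply/val_inj; apply/eqP.
by rewrite -pair_eqE /= /pair_eq -!val_eqE /= -/(fst_P p) -/(snd_P p) pq1 pq2 !eqxx.
Qed.

Lemma in_P_elt i j : in_P n d i j -> exists p : P_d n d, fst_P p = i /\ snd_P p = j.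
Proof.
move=> ijP; have /and4P[h1 h2 h3 _] := ijP.
have i2n : (i < 2 * n)%N by lia.
have j2n : (j < 2 * n)%N by lia.
by exists (exist _ (Ordinal i2n, Ordinal j2n) ijP).
Qed.

Lemma in_P_val (p : P_d n d) : in_P n d (fst_P p) (snd_P p).
Proof. exact: valP p. Qed.

(** The space in position (i, j), extended by zero outside P_d so that it can be indexed by
    natural numbers and so that row 0 of the triangle is the zero space. *)
Definition entry x i j : {vspace W} :=
  if [pick p | (fst_P p == i) && (snd_P p == j)] is Some p then x p else 0%VS.

Lemma entryE x p : entry x (fst_P p) (snd_P p) = x p.
Proof.
rewrite /entry; case: pickP => [q /andP[/eqP q1 /eqP q2]|/(_ p)].
  by rewrite (P_d_inj q1 q2).
by rewrite !eqxx.
Qed.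

Lemma entry0 x i j : ~~ in_P n d i j -> entry x i j = 0%VS.
Proof.
rewrite /entry; case: pickP => // p /andP[/eqP <- /eqP <-].
by rewrite in_P_val.
Qed.

Lemma in_PW i i' j : (1 <= i <= i')%N -> in_P n d i' j -> in_P n d i j.
Proof.
move=> ii /and4P[h1 h2 h3 /existsP[l h4]]; apply/and4P; split; try lia.
by apply/existsP; exists l; lia.
Qed.

Lemma in_PWr i j j' : (j <= j')%N -> (i + j' <= 2 * n)%N -> in_P n d i j -> in_P n d i j'.
Proof.
move=> jj ij /and4P[h1 h2 h3 /existsP[l h4]]; apply/and4P; split; try lia.
by apply/existsP; exists l; lia.
Qed.

Lemma in_P_d l j : (d l <= j)%N -> (d l + j <= 2 * n)%N -> in_P n d (d l) j.
Proof.
move=> lj ljn; have /andP[d1 _] := d_range l; apply/and4P; split=> //.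
by apply/existsP; exists l; rewrite leqnn.
Qed.

Lemma entry_dim x i j : in_P n d i j -> \dim (entry x i j) = i.
Proof. by move=> /in_P_elt[p [<- <-]]; rewrite entryE grprod_dim. Qed.

Section SpREntries.
Variable x : grprod F (@fst_P n k d) (2 * n).
Hypothesis xR : SpR F n d x.

Lemma entry_Wsub i j : in_P n d i j -> (entry x i j <= Wsub F n i j)%VS.
Proof. by have [H _ _ _] := xR; move=> /in_P_elt[p [<- <-]]; rewrite entryE. Qed.

Lemma entry_isotropic i j : in_P n d i j -> (i + j = 2 * n)%N -> isotropic (entry x i j).
Proof. by have [_ _ _ H] := xR; move=> /in_P_elt[p [<- <-]]; rewrite entryE; apply: H. Qed.

Lemma entryS i j : in_P n d i j -> in_P n d i.+1 j -> (entry x i j <= entry x i.+1 j)%VS.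
Proof.
have [_ H _ _] := xR; move=> /in_P_elt[p [p1 p2]] /in_P_elt[q [q1 q2]].
by have := H p q; rewrite -!entryE p1 p2 q1 q2; apply.
Qed.

Lemma entry_pr i j : in_P n d i j -> in_P n d i j.+1 ->
  (pr F n j.+1 @: entry x i j <= entry x i j.+1)%VS.
Proof.
have [_ _ H _] := xR; move=> /in_P_elt[p [p1 p2]] /in_P_elt[q [q1 q2]].
by have := H p q; rewrite -!entryE p1 p2 q1 q2; apply.
Qed.

Lemma entry_sub i i' j : (1 <= i <= i')%N -> in_P n d i' j ->
  (entry x i j <= entry x i' j)%VS.
Proof.
move=> /andP[i1]; elim: i' => [|i' IH]; first by lia.
rewrite leq_eqVlt => /orP[/eqP->//|ii] ijP.
have ijP' : in_P n d i' j by apply: in_PW ijP; lia.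
by apply: subv_trans (IH _ ijP') (entryS ijP' ijP).
Qed.

Lemma entry_prs i j j' : (j <= j')%N -> (i + j' <= 2 * n)%N -> in_P n d i j ->
  (prs F n j.+1 j' @: entry x i j <= entry x i j')%VS.
Proof.
move=> jj ij ijP; move: jj ij; elim: j' => [|j' IH].
  by rewrite leqn0 => /eqP-> _; rewrite prs_id // lim1g.
rewrite leq_eqVlt => /orP[/eqP->|jj] ij; first by rewrite prs_id // lim1g.
rewrite prsSr ?limg_comp //.
apply: subv_trans (entry_pr (in_PWr _ _ ijP) (in_PWr _ _ ijP)) => //; try lia.
by apply/limgS/IH; lia.
Qed.

End SpREntries.

Lemma diag_mapE x l : diag_map d_range x l = entry x (d l) (d l).
Proof. by rewrite /diag_map /= ffunE -entryE. Qed.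

End Triangle.

Section DiagSpF.
Variables (F : numFieldType) (n k : nat) (d : 'I_k -> nat).
Hypothesis d_range : forall l, (1 <= d l <= n)%N.
Hypothesis d_incr : forall l m : 'I_k, (l < m)%N -> (d l < d m)%N.

(** Both conditions follow by moving along the triangle from (d_l, d_l): rightwards to the
    antidiagonal for isotropy, and rightwards then upwards in i to (d_m, d_m) for the
    inclusion in V_m. *)
Lemma diag_map_SpF : set_fun (SpR F n d) (SpF F n d) (diag_map d_range).
Proof.
move=> x xR.
have dP l : in_P n d (d l) (d l).
  by apply: in_P_d => //; have := d_range l; lia.
split=> [l|l m lm]; rewrite !diag_mapE; have := d_range l => dl.
  have dP' : in_P n d (d l) (2 * n - d l)%N by apply: in_P_d => //; lia.
  have Eiso : isotropic (entry x (d l) (2 * n - d l)%N).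
    by apply: entry_isotropic => //; lia.
  by apply: isotropicS Eiso; apply: entry_prs => //; lia.
have dlm : (d l < d m)%N by apply: d_incr; rewrite lm.
have := d_range m => dm.
apply: subv_trans (entry_prs xR _ _ (dP l)) _; try lia.
by apply: entry_sub => //; lia.
Qed.

End DiagSpF.

(** * The open cell and its chart *)

Section Corner.
Variable (R : pzRingType).

Definition corner m N (A : 'M[R]_(m, N)) : 'M[R]_m := A *m pid_mx m.

Lemma cornerE m N (A : 'M[R]_(m, N)) a (b : 'I_m) (c : 'I_N) :
  c = b :> nat -> corner A a b = A a c.
Proof.
move=> cb; rewrite mxE (bigD1 c) //= big1 => [|c' c'c]; rewrite mxE.
  by rewrite cb eqxx ltn_ord mulr1 addr0.
case: eqP => [c'b|]; last by rewrite mulr0.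
by case/eqP: c'c; apply: val_inj; rewrite /= c'b.
Qed.

Lemma corner_mul m N (B : 'M[R]_m) (A : 'M[R]_(m, N)) : corner (B *m A) = B *m corner A.
Proof. by rewrite /corner mulmxA. Qed.

End Corner.

Section Cell.
Variables (F : fieldType) (I : finType) (r : I -> nat) (N : nat).
Implicit Types (A : frame F r N) (V : grprod F r N).

(** The points at which each subspace is complementary to the span of the last
    coordinate vectors. *)
Definition cell : set (grprod F r N) :=
  [set V | exists2 A, is_frame A V & forall s, \det (corner (A s)) != 0].

Lemma cellP A V : is_frame A V -> cell V <-> forall s, \det (corner (A s)) != 0.
Proof.
move=> AV; split=> [[B BV Bdet] s|Adet]; last by exists A.
have [G _ AG] := frame_change AV BV.
move: (Bdet s); rewrite AG corner_mul det_mulmx mulf_eq0 negb_or.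
by case/andP.
Qed.

Lemma cell_open : open cell.
Proof.
apply/open_zariski.
exists [set p | forall A, frame_eval p A = \prod_s \det (corner (A s))] => A V AV.
rewrite (cellP AV); split=> [Adet|[p -> ]]; last first.
  by rewrite prodf_seq_neq0 => /allP H s; apply: (implyP (H s _)); rewrite ?mem_index_enum.
have [p pP] : polyfun (fun A : frame F r N => \prod_s \det (corner (A s))).
  apply: polyfun_prod => s; apply: polyfun_det.
  apply: polyfun_mulmx => a b; first exact: polyfun_entry.
  exact: polyfun_const.
by exists p => //; rewrite pP; apply/prodf_neq0 => s _.
Qed.

(** The reduced row echelon form of A multiplied by \det (corner A), so that its entries
    are polynomials in those of A. *)
Definition echelon m (A : 'M[F]_(m, N)) := \adj (corner A) *m A.

Lemma corner_echelon m (A : 'M[F]_(m, N)) : corner (echelon A) = (\det (corner A))%:M.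
Proof. by rewrite corner_mul mul_adj_mx. Qed.

Lemma echelon_span m (A : 'M[F]_(m, N)) (c : 'rV_m) : \det (corner A) != 0 ->
  exists c', c *m A = c' *m echelon A.
Proof.
move=> A0; exists ((\det (corner A))^-1 *: (c *m corner A)).
rewrite -scalemxAl /echelon mulmxA -(mulmxA c (corner A)) mul_mx_adj.
by rewrite mul_mx_scalar -scalemxAl scalerA mulVf // scale1r.
Qed.

Lemma echelon_coord m (A : 'M[F]_(m, N)) (c : 'rV_m) (a : 'I_m) (b : 'I_N) :
  b = a :> nat -> (c *m echelon A) 0 b = \det (corner A) * c 0 a.
Proof.
move=> ba; transitivity ((c *m corner (echelon A)) 0 a).
  by rewrite !mxE; apply: eq_bigr => a' _; rewrite (cornerE _ _ ba).
by rewrite corner_echelon mul_mx_scalar mxE.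
Qed.

End Cell.

Section Chart.
Variables (F : numFieldType) (n k : nat) (d : 'I_k -> nat).
Hypothesis d_range : forall l, (1 <= d l <= n)%N.
Local Notation W := 'rV[F]_(2 * n).

Lemma P_col_ex (p : P_d n d) : exists l, (fst_P p <= d l <= snd_P p)%N.
Proof. by have [_ _ _] := in_PP p. Qed.

(** Over the cell the chart gives the same space whichever d_l between i and j is used. *)
Definition P_col (p : P_d n d) : 'I_k := xchoose (P_col_ex p).

Lemma P_colP p : (fst_P p <= d (P_col p) <= snd_P p)%N.
Proof. exact: xchooseP (P_col_ex p). Qed.

Lemma P_col_le p : (fst_P p <= d (P_col p))%N.
Proof. by have /andP[] := P_colP p. Qed.

(** A frame of V_{i,j} over the cell: the first i rows of the echelon form of V_{d_l}, with
    i <= d_l <= j, projected along w_{d_l+1}, ..., w_j. *)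
Definition chart (A : frame F d (2 * n)) : frame F (@fst_P n k d) (2 * n) :=
  fun p => \matrix_(a, c) if (d (P_col p) < c.+1 <= snd_P p)%N then 0
           else echelon (A (P_col p)) (widen_ord (P_col_le p) a) c.

Lemma polyfun_chart p a b : polyfun (fun A => chart A p a b).
Proof.
under eq_fun do rewrite mxE.
case: (d (P_col p) < b.+1 <= snd_P p)%N; first exact: polyfun_const.
apply: polyfun_mulmx => [a' b'|a' b']; last exact: polyfun_entry.
apply: polyfun_adj; apply: polyfun_mulmx => a1 b1; first exact: polyfun_entry.
exact: polyfun_const.
Qed.

Lemma row_chart A p a :
  row a (chart A p) = prs F n (d (P_col p)).+1 (snd_P p)
                        (row (widen_ord (P_col_le p) a) (echelon (A (P_col p)))).
Proof. by apply/rowP=> c; rewrite !mxE prsE; case: ifP => _ //; rewrite !mxE. Qed.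

(** Over the cell a point of SpR is determined by its diagonal. Elements of V_{i,d_l} lie
    in V_{d_l,d_l} and have no coordinates i+1, ..., d_l, so they are combinations of the
    first i rows of the echelon form; by dimension these rows span V_{i,d_l}. Their
    projections lie in V_{i,j} and stay independent, because the first i coordinates
    are untouched. *)
Lemma chart_frame A x : SpR F n d x -> is_frame A (diag_map d_range x) ->
  (forall l, \det (corner (A l)) != 0) -> is_frame (chart A) x.
Proof.
move=> xR Ax A0 p.
have [i1 ij ijn _] := in_PP p; have /andP[il lj] := P_colP p.
have dl := d_range (P_col p); set l := P_col p in il lj dl *.
have D0 := A0 l; set D := \det (corner (A l)) in D0.
pose M0 : 'M[F]_(fst_P p, 2 * n) := \matrix_a row (widen_ord (P_col_le p) a) (echelon (A l)).
have ijP : in_P n d (fst_P p) (d l).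
  by apply: in_PW (in_P_d d_range (l := l) (j := d l) _ _) => //; lia.
have EM0 : (entry x (fst_P p) (d l) <= <<[seq row a M0 | a <- enum 'I_(fst_P p)]>>)%VS.
  apply/subvP=> u uE; apply/span_rowsP.
  have uV : u \in diag_map d_range x l.
    rewrite diag_mapE; apply: subvP uE; apply: entry_sub => //; first by lia.
    by apply: in_P_d => //; lia.
  have [c0 u_c0] : exists c, u = c *m A l by have /frameP H := Ax; apply/H.
  have [c uc] := echelon_span c0 D0; rewrite u_c0 uc in uE *.
  exists (\row_a c 0 (widen_ord (P_col_le p) a)).
  have c0' (a : 'I_(d l)) : (fst_P p <= a)%N -> c 0 a = 0.
    move=> pa; have a2n : (a < 2 * n)%N by have := ltn_ord a; lia.
    have /WsubP/(_ (Ordinal a2n)) := subvP (entry_Wsub xR ijP) _ uE.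
    rewrite (@echelon_coord _ _ _ _ _ a) // => /(_ _)/eqP; rewrite mulf_eq0 (negbTE D0) => H.
    by apply/eqP/H => /=; have := ltn_ord a; lia.
  rewrite !mulmx_sum_row (bigID (fun a : 'I_(d l) => (a < fst_P p)%N)) /= [X in _ + X]big1.
    rewrite addr0 (big_ord_narrow (P_col_le p)); apply: eq_bigr => a _.
    by rewrite mxE rowK.
  by move=> a; rewrite -leqNgt => /c0'->; rewrite scale0r.
have M0E a : row a M0 \in entry x (fst_P p) (d l).
  have /eqP -> : entry x (fst_P p) (d l) == <<[seq row a M0 | a <- enum 'I_(fst_P p)]>>%VS.
    rewrite eqEdim EM0 entry_dim //; apply: leq_trans (dim_span _) _.
    by rewrite size_map size_enum_ord.
  by apply/memv_span/map_f; rewrite mem_enum.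
have TE a : row a (chart A p) \in x p.
  rewrite row_chart -/l -entryE; apply: subvP (entry_prs xR (j := d l) _ _ ijP) _ _ => //.
  by apply: memv_img; have := M0E a; rewrite rowK.
have fT : row_free (chart A p).
  suff cT : corner (chart A p) = D%:M.
    apply/row_freeP; exists (pid_mx (fst_P p) *m (D^-1)%:M).
    rewrite mulmxA -/(corner (chart A p)) cT.
    by rewrite -scalar_mxM mulfV.
  apply/matrixP=> a b; have b2n : (b < 2 * n)%N by have := ltn_ord b; lia.
  rewrite (cornerE _ _ (c := Ordinal b2n)) // mxE ifF /=; last first.
    by rewrite -/l; have := ltn_ord b; lia.
  have bl : (b < d l)%N by have := ltn_ord b; lia.
  rewrite -(cornerE _ _ (b := Ordinal bl)) // corner_echelon !mxE.
  by rewrite -!val_eqE.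
have bT := free_rows_basis fT.
suff /eqP -> : x p == <<[seq row a (chart A p) | a <- enum 'I_(fst_P p)]>>%VS by [].
rewrite eq_sym eqEdim grprod_dim; apply/andP; split.
  by apply/span_subvP => _ /mapP[a _ ->].
by have /basis_rowsP[-> _] := bT.
Qed.

End Chart.

(** * Linear algebra over polynomials *)

Section PolyMatrix.
Variable F : fieldType.

Local Notation ev t := (map_mx (horner_eval t)).
Local Notation const := (map_mx (@polyC F)).

Lemma ev_const t m N (A : 'M[F]_(m, N)) : ev t (const A) = A.
Proof. by apply/matrixP=> a b; rewrite !mxE /horner_eval hornerC. Qed.

(** A solution of a linear system at t = 0 extends to a polynomial solution near t = 0 when
    the system has full rank there. With D = M B, where B is a right inverse of M at 0,
    the vector det D y0 - B adj(D) M y0 is in the kernel of M by Cramer's rule, and D is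
    the identity at 0. *)
Lemma polynomial_kernel m N (M : 'M[{poly F}]_(m, N)) (B : 'M[F]_(N, m)) (y0 : 'cV_N) :
  ev 0 M *m B = 1%:M -> ev 0 M *m y0 = 0 ->
  exists c : {poly F}, exists s,
    let y := c *: const y0 - const B *m s in M *m y = 0 /\ ev 0 y = y0.
Proof.
move=> MB My0; pose D := M *m const B.
exists (\det D), (\adj D *m (M *m const y0)) => /=; split.
  rewrite mulmxBr -scalemxAr !mulmxA -/D mul_mx_adj -mulmxA mul_scalar_mx.
  by rewrite subrr.
have D0 : ev 0 D = 1%:M by rewrite map_mxM ev_const.
rewrite map_mxB map_mxZ !map_mxM !ev_const My0 !mulmx0 subr0.
by rewrite -det_map_mx D0 det1 scale1r.
Qed.

Lemma ev_gram n t : ev t (gram n {poly F}) = gram n F.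
Proof.
apply/matrixP=> a b; rewrite !mxE rmorphM rmorphXn rmorphN1 rmorph_nat.
by [].
Qed.

(** B is a family of i independent vectors in W_{i,j}, depending on t, and u a vector of
    W_{i+1,j} orthogonal to them at t = 0, where (i+1, j) is on the antidiagonal. The
    vector u deforms to one which stays orthogonal to B and whose coordinate on w_{i+1} is
    a nonzero polynomial. *)
Lemma edge_vector n i j (B : 'M[{poly F}]_(i, 2 * n)) (u : 'rV[F]_(2 * n))
    (i2n : (i < 2 * n)%N) :
  (i < j)%N -> (i + j).+1 = (2 * n)%N ->
  (forall a (c : 'I_(2 * n)), (i <= c < j)%N -> B a c = 0) -> \det (corner B) != 0 ->
  row_free (ev 0 B) ->
  (forall c : 'I_(2 * n), (i < c < j)%N -> u 0 c = 0) -> ev 0 B *m gram n F *m u^T = 0 ->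
  exists y : 'rV[{poly F}]_(2 * n),
    [/\ ev 0 y = u, forall c : 'I_(2 * n), (i < c < j)%N -> y 0 c = 0,
        B *m gram n _ *m y^T = 0 & y 0 (Ordinal i2n) != 0].
Proof.
move=> ij ijn BW detB /row_freeP[B' BB'] uW Bu.
(* B and u have no coordinates on w_{i+2}, ..., w_j. Dropping them from the right inverse
   keeps it a right inverse and makes the solution y stay in W_{i+1,j}. *)
pose N0 : 'M[F]_(2 * n, i) := \matrix_(c, a) if (i < c < j)%N then 0 else B' c a.
have BN0 : ev 0 B *m N0 = 1%:M.
  rewrite -BB'; apply/matrixP=> a b; rewrite !mxE; apply: eq_bigr => c _.
  rewrite !mxE; case: ifP => // ic; rewrite BW ?rmorph0 ?mul0r //; lia.
have MN : ev 0 (B *m gram n _) *m (- gram n F *m N0) = 1%:M.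
  rewrite map_mxM ev_gram mulNmx mulmxN !mulmxA -(mulmxA (ev 0 B)) gram_sqr.
  by rewrite mulmxN mulmx1 mulNmx opprK.
have Mu : ev 0 (B *m gram n _) *m u^T = 0 by rewrite map_mxM ev_gram.
have [c [s [My y0]]] := polynomial_kernel MN Mu.
set y := _ - _ in My y0.
have yW (b : 'I_(2 * n)) : (i < b < j)%N -> y b 0 = 0.
  move=> ib; rewrite /y mxE mxE [X in _ * X]mxE mxE uW // rmorph0 mulr0 add0r.
  rewrite 2!mxE big1 ?oppr0 // => a _.
  rewrite mxE mulNmx [X in X%:P]mxE gram_mul mxE ifT ?mulr0 ?oppr0 ?mul0r //.
  by rewrite /=; lia.
(* If the coordinate of y on w_{i+1} vanishes, add t z, where z is in the kernel too and
   has the coordinate \det (corner B) there: z is a multiple of w_{i+1} corrected on the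
   partners of w_1, ..., w_i, the correction being found by inverting corner B. *)
pose e : 'cV[{poly F}]_(2 * n) := delta_mx (Ordinal i2n) 0.
pose P : 'M[{poly F}]_(2 * n, i) := pid_mx i.
pose zeta := - (\adj (corner B) *m (B *m gram n _ *m e)).
pose z := \det (corner B) *: e - gram n _ *m (P *m zeta).
have Pzeta (b : 'I_(2 * n)) : (i <= b)%N -> (P *m zeta) b 0 = 0.
  move=> ib; rewrite mxE big1 // => a _; rewrite mxE.
  by rewrite (_ : (b < i)%N = false) ?andbF ?mul0r //; lia.
have Mz : B *m gram n _ *m z = 0.
  rewrite mulmxBr -scalemxAr !mulmxA -(mulmxA B (gram n _) (gram n _)) gram_sqr (mulmxN B) mulmx1.
  rewrite !mulNmx opprK -/(corner B) /zeta mulmxN mulmxA mul_mx_adj mul_scalar_mx.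
  by rewrite subrr.
have zW (b : 'I_(2 * n)) : (i < b < j)%N -> z b 0 = 0.
  move=> ib; rewrite /z mxE [X in _ + X]mxE gram_mul Pzeta ?mulr0 ?oppr0 ?addr0.
    rewrite !mxE (_ : (b == Ordinal i2n) = false) ?mulr0 //.
    by apply/negP=> /eqP bi; move: ib; rewrite bi /= ltnn.
  by rewrite /=; lia.
have zi : z (Ordinal i2n) 0 = \det (corner B).
  rewrite /z mxE [X in _ + X]mxE gram_mul Pzeta ?mulr0 ?oppr0 ?addr0 ?mxE ?eqxx ?mulr1 //=.
  by lia.
have [yi|yi] := eqVneq (y (Ordinal i2n) 0) 0; last first.
  exists y^T; rewrite trmxK; split=> //; last by rewrite mxE.
    by rewrite -map_trmx y0 trmxK.
  by move=> b ib; rewrite mxE yW.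
exists (y + 'X *: z)^T; rewrite trmxK; split.
- rewrite -map_trmx map_mxD map_mxZ y0 /= /horner_eval hornerX scale0r addr0.
  exact: trmxK.
- by move=> b ib; rewrite mxE mxE yW // mxE zW // mulr0 addr0.
- by rewrite mulmxDr My -scalemxAr Mz scaler0 addr0.
- by rewrite mxE mxE yi add0r mxE zi mulf_neq0 ?polyX_eq0.
Qed.

End PolyMatrix.

(** * Curves through a point of the resolution *)

Section Curve.
Variables (F : numFieldType) (n k : nat) (d : 'I_k -> nat).
Local Notation W := 'rV[F]_(2 * n).
Local Notation PW := 'rV[{poly F}]_(2 * n).
Local Notation ev t := (@map_mx _ _ (@horner_eval F t) _ _).
Local Notation const := (@map_mx _ _ (@polyC F) _ _).

Implicit Types v : nat -> PW.

Definition rows_mx (R : Type) N (v : nat -> 'rV[R]_N) i : 'M[R]_(i, N) := \matrix_(a < i) v a.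

Definition span_at (t : F) (v : nat -> PW) i : {vspace W} :=
  <<[seq ev t (v a) | a <- iota 0 i]>>%VS.

Lemma rows_at t v i :
  [seq row a (ev t (rows_mx v i)) | a <- enum 'I_i] = [seq ev t (v a) | a <- iota 0 i].
Proof.
rewrite -val_enum_ord -map_comp; apply: eq_map => a /=.
by rewrite -map_row rowK.
Qed.

Lemma mem_span_at t v i a : (a < i)%N -> ev t (v a) \in span_at t v i.
Proof. by move=> ai; apply/memv_span/map_f; rewrite mem_iota. Qed.

Lemma span_atP t v i u :
  reflect (exists c : nat -> F, u = \sum_(b < i) c b *: ev t (v b)) (u \in span_at t v i).
Proof.
apply: (iffP idP) => [|[c ->]]; last first.
  by apply: memv_suml => b _; apply/memvZ/mem_span_at.
rewrite /span_at -rows_at => /span_rowsP[c ->].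
exists (fun b => if insub b is Some b' then c 0 b' else 0).
rewrite mulmx_sum_row; apply: eq_bigr => b _; rewrite insubT // => bi.
by rewrite -map_row rowK; congr (c 0 _ *: _); apply: val_inj.
Qed.

Lemma span_atS t v i : span_at t v i.+1 = (span_at t v i + <[ev t (v i)]>)%VS.
Proof. by rewrite /span_at -[i.+1]addn1 iotaD map_cat span_cat span_seq1. Qed.

Lemma corner_ev t m N (A : 'M[{poly F}]_(m, N)) : corner (ev t A) = ev t (corner A).
Proof. by rewrite /corner map_mxM map_pid_mx. Qed.

Lemma corner_rows (R : pzRingType) N (v : nat -> 'rV[R]_N) i (a b : 'I_i) (c : 'I_N) :
  c = b :> nat -> corner (rows_mx v i) a b = v a 0 c.
Proof. by move=> cb; rewrite (cornerE _ _ cb) mxE. Qed.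

Variable x : grprod F (@fst_P n k d) (2 * n).
Hypothesis xR : SpR F n d x.
Local Notation E := (entry x).
Local Notation inP := (in_P n d).

(** Polynomial vectors v 0, v 1, ... such that the first i of them are a basis of the
    deformation of E i j. At t = 0, v a has to complete E a j to E (a+1) j. The other
    clauses are the position in W_{i,j}, the generic position with respect to the cell,
    and isotropy on the antidiagonal. *)
Definition column_curve j (v : nat -> PW) : Prop :=
  [/\ forall a, inP a.+1 j -> ev 0 (v a) \in E a.+1 j /\ ev 0 (v a) \notin E a j,
      forall a, inP a.+1 j -> forall c : 'I_(2 * n), (a < c < j)%N -> v a 0 c = 0,
      forall i, inP i j -> \det (corner (rows_mx v i)) != 0 &
      forall i t, inP i j -> (i + j = 2 * n)%N -> isotropic (span_at t v i)].

Definition combination j (v1 : nat -> PW) (p : (nat -> {poly F}) * {poly F}) a : PW :=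
  \sum_(b < a.+1) p.1 b *: v1 b + p.2 *: const (w F n j.+1).

(** This relation between two columns makes pr_{j+1} map V_{i,j} into V_{i,j+1} all along
    the deformation. *)
Definition linked j (v v1 : nat -> PW) : Prop :=
  forall a, inP a.+1 j -> inP a.+1 j.+1 -> exists p, v a = combination j v1 p a.

Lemma E0 j : E 0 j = 0%VS. Proof. by rewrite entry0. Qed.

Lemma inP_leq i i' j : (i <= i')%N -> inP i' j -> (i == 0%N) || inP i j.
Proof.
by case: i => // i ii /in_PW; apply.
Qed.

Lemma dimE i i' j : (i <= i')%N -> inP i' j -> \dim (E i j) = i.
Proof.
move=> ii /(inP_leq ii)/orP[/eqP->|]; first by rewrite E0 dimv0.
exact: entry_dim.
Qed.

Lemma E_sub i i' j : (i <= i')%N -> inP i' j -> (E i j <= E i' j)%VS.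
Proof.
case: i => [|i] ii ijP; first by rewrite E0 sub0v.
exact: entry_sub.
Qed.

(** One vector in each step of a full flag spans the flag. *)
Lemma flag_span j v i i' : (i <= i')%N -> inP i' j ->
  (forall a, (a < i)%N -> ev 0 (v a) \in E a.+1 j /\ ev 0 (v a) \notin E a j) ->
  E i j = span_at 0 v i.
Proof.
move=> + ijP; elim: i => [|i IH] ii v0; first by rewrite E0 /span_at /= span_nil.
have iP : inP i.+1 j by have := inP_leq ii ijP.
have [vi vNi] := v0 _ (ltnSn i).
rewrite span_atS -IH ?(ltnW ii) // => [|a ai]; last by apply/v0/ltnW.
apply/esym/eqP; rewrite eqEdim subv_add E_sub //= dim_add_line // !(dimE _ iP) //.
by rewrite leqnn andbT; apply/subvP=> u /vlineP[c ->]; apply: memvZ.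
Qed.

Lemma column_curve_span j v i : column_curve j v -> inP i j -> E i j = span_at 0 v i.
Proof.
move=> [v0 _ _ _] ijP; apply: (flag_span (leqnn i)) => // a ai.
by apply: v0; have := inP_leq ai ijP.
Qed.

Lemma flag_basis j v i i' : (i <= i')%N -> inP i' j ->
  (forall a, (a < i)%N -> ev 0 (v a) \in E a.+1 j /\ ev 0 (v a) \notin E a j) ->
  basis_of (E i j) [seq row a (ev 0 (rows_mx v i)) | a <- enum 'I_i].
Proof.
move=> ii ijP v0; rewrite rows_at basisEdim -/(span_at _ _ _) -(flag_span ii ijP v0).
by rewrite subvv size_map size_iota (dimE ii ijP) /=.
Qed.

Lemma isotropic_rows t v i :
  (forall a b, (a < i)%N -> (b < i)%N -> omega (ev t (v a)) (ev t (v b)) = 0) ->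
  isotropic (span_at t v i).
Proof.
move=> iso _ _ /span_atP[c ->] /span_atP[c' ->].
rewrite omegaE mulmx_suml linear_sum mulmx_sumr summxE big1 // => b' _.
rewrite linearZ -scalemxAr mxE mulmx_suml summxE big1 ?mulr0 // => b _.
by rewrite -!scalemxAl mxE -omegaE iso ?mulr0.
Qed.

(** Off the antidiagonal, V_{a+1,j} is only required to contain V_{a,j} and to lie in the
    span of V_{a+1,j+1} and w_{j+1}, so the coefficients of a new basis vector u on the
    vectors of column j+1 can be moved freely. Adding t to the coefficient of the last one
    makes it a nonzero polynomial. *)
Lemma interior_vectors j v1 : column_curve j.+1 v1 ->
  exists f : nat -> (nat -> {poly F}) * {poly F},
  forall a, inP a.+1 j -> inP a.+1 j.+1 ->
  [/\ ev 0 (combination j v1 (f a) a) \in E a.+1 j,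
      ev 0 (combination j v1 (f a) a) \notin E a j & (f a).1 a != 0].
Proof.
move=> v1P; suff /choice[f fP] : forall a, exists p, inP a.+1 j -> inP a.+1 j.+1 ->
    [/\ ev 0 (combination j v1 p a) \in E a.+1 j,
        ev 0 (combination j v1 p a) \notin E a j & p.1 a != 0] by exists f.
move=> a; have [aP|naP] := boolP (inP a.+1 j); last by exists (fun=> 0, 0).
have [aP1|naP1] := boolP (inP a.+1 j.+1); last by exists (fun=> 0, 0).
have /subvPn[u uE uNE] : ~~ (E a.+1 j <= E a j)%VS.
  by apply/negP=> /dimvS; rewrite (dimE _ aP) // (dimE _ aP) // ltnn.
have [b ub] := pr_decomp j.+1 u.
have : pr F n j.+1 u \in E a.+1 j.+1 by apply: subvP (entry_pr xR aP aP1) _ _; apply: memv_img.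
rewrite (column_curve_span v1P aP1) => /span_atP[c uc].
exists (fun b => (c b)%:P + (if b == a then 'X else 0), b%:P) => _ _ /=.
suff -> : ev 0 (combination j v1
   (fun b => (c b)%:P + (if b == a then 'X else 0), b%:P) a) = u.
  split=> //; rewrite eqxx; apply/eqP => /(congr1 (fun p : {poly F} => p`_1)).
  by rewrite coefD coefC coefX add0r coef0 => /eqP; rewrite oner_eq0.
rewrite /combination map_mxD map_mxZ ev_const /= /horner_eval hornerC [RHS]ub uc.
congr (_ + _); rewrite (raddf_sum (map_mx (@horner_eval F 0))); apply: eq_bigr => b' _ /=.
rewrite map_mxZ /= /horner_eval hornerD hornerC.
by case: ifP => _; rewrite ?hornerX ?horner0 addr0.
Qed.

Lemma combination_coord j v1 p a (c : 'I_(2 * n)) : column_curve j.+1 v1 ->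
  inP a.+1 j.+1 -> (a < c < j)%N -> combination j v1 p a 0 c = 0.
Proof.
move=> [_ v1W _ _] aP ac.
rewrite mxE summxE big1 => [|b _]; last first.
  rewrite mxE v1W ?mulr0 //; last by have := ltn_ord b; lia.
  by have /orP[] := inP_leq (ltn_ord b) aP.
rewrite !mxE add0r (_ : (c.+1 == j.+1) = false) ?mulr0 //.
by apply/negbTE; rewrite neq_ltn; lia.
Qed.

(** The matrix expressing the combinations in terms of v1 is lower triangular, and w_{j+1}
    has no coordinate in the corner. *)
Lemma combination_corner j v1 f i : column_curve j.+1 v1 -> (i <= j)%N ->
  inP i j.+1 -> (forall a, (a < i)%N -> (f a).1 a != 0) ->
  \det (corner (rows_mx (fun a => combination j v1 (f a) a) i)) != 0.
Proof.
move=> [_ _ det1 _] ij iP f0.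
pose K : 'M[{poly F}]_i := \matrix_(a, b) if (b <= a)%N then (f a).1 b else 0.
have -> : corner (rows_mx (fun a => combination j v1 (f a) a) i) = K *m corner (rows_mx v1 i).
  apply/matrixP=> a b; have b2n : (b < 2 * n)%N.
    by have := ltn_ord b; case/and4P: iP; lia.
  rewrite (@corner_rows _ _ _ _ _ _ (Ordinal b2n)) // !mxE.
  rewrite (_ : ((Ordinal b2n).+1 == j.+1) = false) ?mulr0 ?addr0; last first.
    by apply/negbTE; rewrite neq_ltn /=; have := ltn_ord b; lia.
  rewrite summxE [RHS](bigID (fun b' : 'I_i => (b' < a.+1)%N)) /= [X in _ = _ + X]big1.
    rewrite addr0 (big_ord_narrow (ltn_ord a)); apply: eq_bigr => b' _.
    rewrite [in RHS]mxE ifT; last by have := ltn_ord b'; rewrite ltnS.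
    by rewrite (@corner_rows _ _ _ _ _ _ (Ordinal b2n)) // mxE.
  move=> b'; rewrite -leqNgt => ab; rewrite mxE ifF ?mul0r //.
  by apply/negbTE; rewrite -ltnNge.
rewrite det_mulmx mulf_neq0 ?det1 // det_trig; last first.
  by apply/is_trig_mxP => a b ab; rewrite mxE ifF //; apply/negbTE; rewrite -ltnNge.
by apply/prodf_neq0 => a _; rewrite mxE leqnn f0.
Qed.

Lemma ev_combination t j v1 p a : ev t (combination j v1 p a) =
  \sum_(b < a.+1) (p.1 b).[t] *: ev t (v1 b) + (p.2).[t] *: w F n j.+1.
Proof.
rewrite /combination map_mxD map_mxZ ev_const (raddf_sum (map_mx (@horner_eval F t))).
by congr (_ + _); apply: eq_bigr => b _ /=; rewrite map_mxZ.
Qed.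

Lemma omega_w_eq0 (u : W) (c : 'I_(2 * n)) j : (c + j.+1 = 2 * n)%N -> u 0 c = 0 ->
  omega u (w F n j.+1) = 0.
Proof.
move=> cj uc; apply: big1 => b _; rewrite mxE.
have [->|bc] := eqVneq b c; first by rewrite uc mulr0 mul0r.
rewrite (_ : ((rev_ord b).+1 == j.+1) = false) ?mulr0 //.
apply/negP=> /eqP bj; case/eqP: bc; apply: val_inj; move: bj => /=.
by have := ltn_ord b; lia.
Qed.

(** The combinations lie in the sum of an isotropic space, spanned by vectors of column
    j+1, and of the line of w_{j+1}, whose partner w_{i+1} does not occur in that space. *)
Lemma combination_isotropic t j v1 f i : column_curve j.+1 v1 ->
  inP i j.+1 -> (i <= j)%N -> (i + j.+1 = 2 * n)%N ->
  forall a b, (a < i)%N -> (b < i)%N ->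
  omega (ev t (combination j v1 (f a) a)) (ev t (combination j v1 (f b) b)) = 0.
Proof.
move=> [_ v1W _ v1iso] iP ile ij a b ai bi.
have i2n : (i < 2 * n)%N by lia.
suff spanP c : (c < i)%N -> exists u : W, exists s : F,
    [/\ ev t (combination j v1 (f c) c) = u + s *: w F n j.+1,
        u \in span_at t v1 i & u 0 (Ordinal i2n) = 0].
  have [u [s [-> uS u0]]] := spanP a ai; have [u' [s' [-> u'S u'0]]] := spanP b bi.
  rewrite !omegaDl !omegaDr !omegaZl !omegaZr omega_self (v1iso i t iP ij) //.
  rewrite (omegaC (w F n j.+1)) !(@omega_w_eq0 _ (Ordinal i2n)) //=.
  by rewrite !(mulr0, oppr0, addr0).
move=> ci; rewrite ev_combination.
exists (\sum_(b0 < c.+1) ((f c).1 b0).[t] *: ev t (v1 b0)), ((f c).2).[t]; split=> //.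
  apply: memv_suml => b0 _; apply/memvZ/mem_span_at.
  by have := ltn_ord b0; lia.
rewrite summxE big1 // => b0 _; rewrite !mxE v1W ?rmorph0 ?mulr0 //=.
  by have := ltn_ord b0 => b0c; have /orP[] := inP_leq (leq_trans b0c ci) iP.
by have := ltn_ord b0; case/and4P: iP; lia.
Qed.

(** All entries of the last column of the corner vanish, except possibly the one from y. *)
Lemma det_corner_rcons v y i (i2n : (i < 2 * n)%N) :
  (forall a, (a < i)%N -> v a 0 (Ordinal i2n) = 0) ->
  \det (corner (rows_mx (fun a => if a == i then y else v a) i.+1)) =
  y 0 (Ordinal i2n) * \det (corner (rows_mx v i)).
Proof.
move=> v0; set C := corner _.
have CE (a b : 'I_i.+1) (c : 'I_(2 * n)) : c = b :> nat ->
    C a b = if a == i :> nat then y 0 c else v a 0 c.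
  by move=> cb; rewrite /C (corner_rows _ _ cb); case: ifP.
rewrite (expand_det_col _ ord_max) big_ord_recr /= big1 ?add0r => [|a _]; last first.
  by rewrite (CE _ _ (Ordinal i2n)) //= ltn_eqF ?v0 ?mul0r.
rewrite (CE _ _ (Ordinal i2n)) //= eqxx /cofactor -signr_odd oddD addbb expr0 mul1r.
congr (_ * \det _); apply/matrixP=> a b.
have b2n : (b < 2 * n)%N by have := ltn_ord b; lia.
rewrite 2!mxE (CE _ _ (Ordinal b2n)) ?lift_max //= ltn_eqF //.
by rewrite (@corner_rows _ _ _ _ _ _ (Ordinal b2n)).
Qed.

(** The vectors of column j are combinations of those of column j+1 and w_{j+1}, except
    possibly the last one, in the antidiagonal position, which edge_vector supplies. *)
Lemma column_step j v1 : column_curve j.+1 v1 ->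
  exists v, column_curve j v /\ linked j v v1.
Proof.
move=> v1P; have [f fP] := interior_vectors v1P.
pose v' a := combination j v1 (f a) a.
have interior a : inP a.+1 j -> (a.+1 + j < 2 * n)%N -> inP a.+1 j.+1.
  by move=> aP aj; apply: in_PWr aP; lia.
(* In each column at most one position, (i + 1, j), is on the antidiagonal. *)
have [[i [iP ij]]|no] := pselect (exists i, inP i.+1 j /\ (i.+1 + j = 2 * n)%N); last first.
  have int a : inP a.+1 j -> inP a.+1 j.+1.
    move=> aP; apply: interior => //; rewrite ltn_neqAle; case/and4P: (aP) => _ _ -> _.
    by rewrite andbT; apply/eqP=> aj; case: no; exists a.
  exists v'; split; last by move=> a _ _; exists (f a).
  split=> [a aP|a aP c ac|i iP|i t iP ij].
  - by have [] := fP a aP (int a aP).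
  - by apply: (combination_coord _ v1P) => //; apply: int.
  - case: i iP => [//|i] iP; have ile : (i < j)%N by case/and4P: iP.
    apply: (combination_corner v1P) => //; first exact: int.
    move=> a ai; have aP : inP a.+1 j by apply: in_PW iP; lia.
    by have [] := fP a aP (int a aP).
  - by case: no; case: i iP ij => [//|i] iP ij; exists i.
have ilj : (i < j)%N by case/and4P: iP.
have i2n : (i < 2 * n)%N by lia.
have aP a : (a < i)%N -> inP a.+1 j by move=> ai; apply: in_PW iP; lia.
have aP1 a : (a < i)%N -> inP a.+1 j.+1.
  by move=> ai; apply: interior (aP a ai) _; lia.
have v'W a (c : 'I_(2 * n)) : (a < i)%N -> (a < c < j)%N -> v' a 0 c = 0.
  by move=> ai ac; apply: (combination_coord _ v1P) => //; apply: aP1.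
have v'0 a : (a < i)%N -> ev 0 (v' a) \in E a.+1 j /\ ev 0 (v' a) \notin E a j.
  by move=> ai; have [] := fP a (aP a ai) (aP1 a ai).
have det' i' : (i' <= i)%N -> \det (corner (rows_mx v' i')) != 0.
  case: i' => [|i'] ii; first by rewrite det_mx00 oner_neq0.
  apply: (combination_corner v1P); [lia | exact: aP1 |] => a ai'.
  have ai : (a < i)%N by lia.
  by have [] := fP a (aP a ai) (aP1 a ai).
have /subvPn[u uE uNE] : ~~ (E i.+1 j <= E i j)%VS.
  by apply/negP=> /dimvS; rewrite (dimE _ iP) // (dimE _ iP) // ltnn.
have isoE : isotropic (E i.+1 j) := entry_isotropic xR iP ij.
have [||||||y [y0 yW yv yi]] := @edge_vector F n i j (rows_mx v' i) u i2n ilj.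
- by lia.
- by move=> a c ic; rewrite mxE v'W //; have := ltn_ord a; lia.
- exact: det'.
- exact: basis_rows_free (flag_basis (leqnSn i) iP v'0).
- by move=> c ic; have /WsubP := subvP (entry_Wsub xR iP) _ uE; apply.
- apply/row_matrixP=> a; rewrite row0 !row_mul -map_row rowK.
  apply/matrixP=> s s'; rewrite !ord1 -omegaE [RHS]mxE; apply: isoE => //.
  have [vE _] := v'0 a (ltn_ord a).
  by apply: subvP vE; apply: (@E_sub a.+1 i.+1) => //; have := ltn_ord a; lia.
exists (fun a => if a == i then y else v' a); split; last first.
  move=> a aP' aP1'; exists (f a); rewrite ifF //.
  by apply/negbTE/eqP => ai; move: aP1'; rewrite ai; case/and4P; lia.
have lt_or_eq a : inP a.+1 j -> a = i \/ (a < i)%N.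
  by move=> /and4P[_ _ aj _]; case: (ltnP a i) => ?; [right | left; lia].
split=> [a /lt_or_eq[->|ai]|a /lt_or_eq[->|ai] c ac|i' i'P|i' t i'P i'j].
- by rewrite eqxx y0.
- by rewrite ltn_eqF //; apply: v'0.
- by rewrite eqxx yW.
- by rewrite ltn_eqF //; apply: v'W.
- have [->|i'i] : i' = i.+1 \/ (i' <= i)%N by case/and4P: i'P; lia.
    rewrite (@det_corner_rcons _ _ _ i2n) ?mulf_neq0 ?det' // => a ai.
    by apply: v'W => //=; lia.
  suff -> : rows_mx (fun a => if a == i then y else v' a) i' = rows_mx v' i' by apply: det'.
  apply/row_matrixP=> a; rewrite !rowK ltn_eqF //; have := ltn_ord a; lia.
have -> : i' = i.+1 by lia.
have v'y a : (a < i)%N -> omega (ev t (v' a)) (ev t y) = 0.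
  move=> ai; rewrite omegaE -(ev_gram n t) map_trmx -!map_mxM.
  have /row_matrixP/(_ (Ordinal ai)) := yv.
  by rewrite row0 !row_mul rowK /= => ->; rewrite !mxE rmorph0.
have v'v' a b : (a < i)%N -> (b < i)%N -> omega (ev t (v' a)) (ev t (v' b)) = 0.
  move=> ai bi; have i0 : (0 < i)%N by lia.
  have iPj : inP i j by apply: in_PW iP; lia.
  apply: (@combination_isotropic _ _ _ _ i v1P) => //; try lia.
  by apply: in_PWr iPj; lia.
apply: isotropic_rows => a b; rewrite !ltnS leq_eqVlt => /orP[/eqP->|ai].
  rewrite eqxx leq_eqVlt => /orP[/eqP->|bi]; first by rewrite eqxx omega_self.
  by rewrite ltn_eqF // omegaC v'y ?oppr0.
rewrite (ltn_eqF ai) leq_eqVlt => /orP[/eqP->|bi]; first by rewrite eqxx v'y.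
by rewrite ltn_eqF // v'v'.
Qed.

Lemma columns_exist : exists v : nat -> nat -> PW,
  forall j, (j < 2 * n)%N -> column_curve j (v j) /\ linked j (v j) (v j.+1).
Proof.
have /choice[f fP] : forall p : nat * (nat -> PW), exists v, column_curve p.1.+1 p.2 ->
    column_curve p.1 v /\ linked p.1 v p.2.
  move=> [j v1] /=; have [v1P|nv1P] := pselect (column_curve j.+1 v1); last by exists v1.
  by have [v vP] := column_step v1P; exists v.
(* [z m] is the column 2n - m; the column 2n is empty. *)
pose z := fix z m : nat -> PW := if m is m'.+1 then f ((2 * n - m)%N, z m') else fun=> 0.
have zP m : (m <= 2 * n)%N -> column_curve (2 * n - m) (z m).
  elim: m => [|m IH] mn.
    have noP i : inP i (2 * n) = false by apply/negP=> /and4P[i1 _ i2 _]; lia.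
    by rewrite subn0; split=> [a|a|i|i t]; rewrite noP.
  have [] // := fP ((2 * n - m.+1)%N, z m).
  by rewrite /= (_ : (2 * n - m.+1).+1 = (2 * n - m)%N); [apply: IH|]; lia.
exists (fun j => z (2 * n - j)%N) => j jn.
have -> : z (2 * n - j)%N = f (j, z (2 * n - j.+1)%N).
  rewrite (_ : (2 * n - j)%N = (2 * n - j.+1).+1) /=; last by lia.
  by congr (f (_, _)); lia.
apply: (fP (j, z (2 * n - j.+1)%N)) => /=.
by have := zP (2 * n - j.+1)%N (leq_subr _ _); rewrite subKn.
Qed.

End Curve.

(** * Density of the cell *)

Section Density.
Variables (F : numFieldType) (n k : nat) (d : 'I_k -> nat).
Hypothesis d_range : forall l, (1 <= d l <= n)%N.
Local Notation W := 'rV[F]_(2 * n).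
Local Notation ev t := (@map_mx _ _ (@horner_eval F t) _ _).

Lemma poly_nonroot (q : {poly F}) : q != 0 -> exists t, q.[t] != 0.
Proof.
move=> q0; apply: contrapT => noroot.
pose rs := [seq (m%:R : F) | m <- iota 0 (size q)].
have := @max_poly_roots F q rs q0; rewrite size_map size_iota ltnn.
have -> : all (root q) rs.
  apply/allP=> t _; apply/negPn/negP => qt; apply: noroot; exists t.
  by move: qt; rewrite /root.
rewrite map_inj_uniq ?iota_uniq => [/(_ isT isT)//|a b /eqP].
by rewrite Num.Theory.eqr_nat => /eqP.
Qed.

Lemma det_corner_row_free m N (A : 'M[F]_(m, N)) : \det (corner A) != 0 -> row_free A.
Proof.
move=> A0; apply/row_freeP; exists (pid_mx m *m invmx (corner A)).
by rewrite mulmxA -/(corner A) mulmxV // unitmxE unitfE.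
Qed.

Lemma diag_frame (A : frame F (@fst_P n k d) (2 * n)) x : is_frame A x ->
  is_frame ((fun l => A (diag d_range l)) : frame F d (2 * n)) (diag_map d_range x).
Proof. by move=> Ax l; rewrite /= ffunE; apply: Ax. Qed.

(** The columns satisfy the incidence and isotropy conditions identically in t, so that the
    only condition on t is that the vectors remain independent. *)
Lemma curve_SpR (v : nat -> nat -> 'rV[{poly F}]_(2 * n)) x t V : SpR F n d x ->
  (forall j, (j < 2 * n)%N -> column_curve x j (v j) /\ linked d j (v j) (v j.+1)) ->
  is_frame (fun p : P_d n d => ev t (rows_mx (v (snd_P p)) (fst_P p))) V ->
  SpR F n d V.
Proof.
move=> xR vP AV.
have VE p : V p = span_at t (v (snd_P p)) (fst_P p).
  by rewrite -(span_basis (AV p)) rows_at.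
have j2n (p : P_d n d) : (snd_P p < 2 * n)%N by apply: ltn_ord.
have in_col (p : P_d n d) a : (a < fst_P p)%N -> in_P n d a.+1 (snd_P p).
  by move=> ap; apply: in_PW (in_P_val p); lia.
have coord0 (p : P_d n d) a (c : 'I_(2 * n)) : (a < fst_P p)%N -> (a < c < snd_P p)%N ->
    (ev t (v (snd_P p) a)) 0 c = 0.
  move=> ap ac; have [[_ vW _ _] _] := vP _ (j2n p).
  by rewrite mxE vW ?rmorph0 //; apply: in_col.
split=> [p|p q pq1 pq2|p q pq1 pq2|p pn]; rewrite !VE.
- apply/span_subvP=> u /mapP[a]; rewrite mem_iota => /andP[_ ap] ->.
  by apply/WsubP => c cp; apply: coord0 => //; lia.
- apply/span_subvP=> u /mapP[a]; rewrite mem_iota => /andP[_ ap] ->.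
  by rewrite pq1 pq2; apply: mem_span_at; apply: ltnW.
- apply/subvP=> _ /memv_imgP[u /span_atP[c ->] ->].
  rewrite linear_sum; apply: memv_suml => a _; rewrite linearZ; apply: memvZ.
  have aq : (a < fst_P q)%N by rewrite pq1.
  have [_ lv] := vP _ (j2n p).
  have := in_col q a aq; rewrite pq2 => aP1.
  have [f ->] := lv a (in_col p a (ltn_ord a)) aP1.
  rewrite ev_combination linearD linear_sum linearZ /=.
  have -> : pr F n (snd_P p).+1 (w F n (snd_P p).+1) = 0.
    by apply/rowP=> c'; rewrite prE !mxE; case: eqP.
  rewrite scaler0 addr0; apply: memv_suml => b _; rewrite linearZ /=; apply: memvZ.
  have bq : (b < fst_P q)%N by apply: leq_ltn_trans aq; rewrite -ltnS.
  have -> : pr F n (snd_P p).+1 (ev t (v (snd_P p).+1 b)) = ev t (v (snd_P p).+1 b).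
    apply/rowP=> c'; rewrite prE -pq2; case: eqP => // cq; apply/esym/coord0 => //.
    have [_ hp _ _] := in_PP p; rewrite pq2 in cq *; lia.
  exact: mem_span_at.
- by have [[_ _ _ iso] _] := vP _ (j2n p); apply: iso => //; apply: in_P_val.
Qed.

(** Let a frame of x vary in the curve through x given by the columns. The
    polynomial p that shows that x is in a given open set, and the corner minors, are
    nonzero polynomials in t, so that they are all nonzero for some t. *)
Lemma chart_dense :
  dense_in (SpR F n d) (SpR F n d `&` diag_map d_range @^-1` @cell F _ d (2 * n)).
Proof.
split=> [x []//|x xR B]; rewrite nbhsE => -[O [/open_zariski[S OS] Ox] OB].
have [v vP] := columns_exist xR.
pose A t : frame F (@fst_P n k d) (2 * n) :=
  fun p => ev t (rows_mx (v (snd_P p)) (fst_P p)).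
have j2n (p : P_d n d) : (snd_P p < 2 * n)%N by apply: ltn_ord.
have A0 : is_frame (A 0) x.
  move=> p; rewrite -entryE; apply: (flag_basis xR (leqnn _) (in_P_val p)) => a ap.
  have [[v0 _ _ _] _] := vP _ (j2n p); apply: v0.
  by apply: in_PW (in_P_val p); lia.
have [p Sp p0] := (OS _ _ A0).1 Ox.
have [q qP] : exists q : {poly F}, forall t, frame_eval p (A t) = q.[t].
  apply: (@polyfun_polynomial F _ _ _ A (frame_eval p)); last by exists p.
  by move=> s a b; exists (v (snd_P s) a 0 b) => t; rewrite !mxE.
pose Q := q * \prod_(s : P_d n d) \det (corner (rows_mx (v (snd_P s)) (fst_P s))).
have [|t Qt] := @poly_nonroot Q.
  rewrite mulf_neq0 //.
    by apply: contraNneq p0 => q0; rewrite qP q0 horner0.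
  by apply/prodf_neq0 => s _; have [[_ _ det0 _] _] := vP _ (j2n s); apply/det0/in_P_val.
move: Qt; rewrite hornerM mulf_eq0 negb_or horner_prod => /andP[qt /prodf_neq0 dett].
have detA s : \det (corner (A t s)) != 0.
  by rewrite corner_ev det_map_mx; apply: dett.
have [V AV] := grprod_of_frame (fun s => det_corner_row_free (detA s)).
exists V; split; last by apply: OB; apply/(OS _ _ AV); exists p; rewrite // qP.
split; first exact: curve_SpR xR vP AV.
exists (fun l => A t (diag d_range l)); first exact: diag_frame.
by move=> l; exact: (detA (diag d_range l)).
Qed.

End Density.

(** * Birationality *)

Lemma within_continuous_open (S T : topologicalType) (X : set S) (f : S -> T) O :
  {within X, continuous f} -> open O -> exists2 O', open O' & X `&` f @^-1` O = X `&` O'.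
Proof.
move=> /continuousP fc Oo; have /open_subspaceP[O' O'o O'E] := fc O Oo.
by exists O'; rewrite // setIC -O'E setIC.
Qed.

Section Birationality.
Variables (F : numFieldType) (n k : nat) (d : 'I_k -> nat).
Hypothesis d_range : forall l, (1 <= d l <= n)%N.
Hypothesis d_incr : forall l m : 'I_k, (l < m)%N -> (d l < d m)%N.
Local Notation phi := (@diag_map F n k d d_range).
Local Notation X := (SpR F n d).
Local Notation Y := (SpF F n d).
Local Notation C := (@cell F _ d (2 * n)).

Lemma diag_map_morphism (X' : set (grprod F (@fst_P n k d) (2 * n))) Y' :
  set_fun X' Y' phi -> morphism X' Y' phi.
Proof.
move=> XY; apply: (frame_map_morphism (T := fun A l => A (diag d_range l))) => //.
  by move=> l a b; exact: (@polyfun_entry F _ (@fst_P n k d) (2 * n) (diag d_range l) a b).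
by move=> A x _; apply: diag_frame.
Qed.

(** Any set-theoretic section psi of the surjection is an inverse over the cell because
    chart_frame makes the preimage unique there; the same lemma shows that chart lifts psi
    to frames, so psi is a morphism. *)
Lemma chart_inverse : exists psi : grprod F d (2 * n) -> grprod F (@fst_P n k d) (2 * n),
  [/\ morphism (Y `&` C) (X `&` phi @^-1` C) psi,
      forall x, (X `&` phi @^-1` C) x -> psi (phi x) = x &
      forall y, (Y `&` C) y -> phi (psi y) = y].
Proof.
(* A value for psi outside SpF. *)
have [A0 A0free] : exists A0 : frame F (@fst_P n k d) (2 * n), forall p, row_free (A0 p).
  exists (fun p => pid_mx (fst_P p)) => p.
  by rewrite /row_free rank_pid_mx //; have [? ? ? _] := in_PP p; lia.
have [x0 _] := grprod_of_frame A0free.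
have /choice[psi psiP] : forall y, exists x, Y y -> X x /\ phi x = y.
  move=> y; have [Yy|nYy] := pselect (Y y); last by exists x0.
  by have [x xR xy] := diag_map_surj d_range d_incr Yy; exists x.
exists psi; split=> [|x [Xx Cx]|y [Yy _]]; last by have [] := psiP y Yy.
  apply: (frame_map_morphism (T := @chart F n k d)).
  - exact: polyfun_chart.
  - move=> y [Yy Cy]; have [Xy yE] := psiP y Yy; split=> //.
    by rewrite /= yE.
  - move=> A y [Yy Cy] Ay; have [Xy yE] := psiP y Yy.
    apply: (chart_frame (d_range := d_range)) => //; first by rewrite yE.
    by apply/(cellP Ay).
have [Xpsi psiE] := psiP (phi x) (diag_map_SpF d_range d_incr Xx).
have [A Ax] := frame_exists (phi x).
have Adet := (cellP Ax).1 Cx.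
apply: (@frame_inj _ _ _ _ (chart A)); apply: (chart_frame (d_range := d_range)) => //.
by rewrite psiE.
Qed.

(** Density of the cell in SpF follows from density of its preimage in SpR, by continuity
    and surjectivity. *)
Theorem diag_map_birational : birational_morphism X Y phi.
Proof.
have XY : set_fun X Y phi := diag_map_SpF d_range d_incr.
have phiM := diag_map_morphism XY.
have [_ phic _] := phiM.
have [U'X XU'] := @chart_dense F n k d d_range.
split=> //; exists (X `&` phi @^-1` C), (Y `&` C); split.
- by have [O Oo OE] := within_continuous_open phic (@cell_open F _ d (2 * n)); exists O.
- exact: chart_dense.
- by exists C; split=> //; apply: cell_open.
- split=> [y []//|y Yy B]; rewrite nbhsE => -[O [Oo Oy] OB].
  have [x Xx xy] := diag_map_surj d_range d_incr Yy.
  have [O' O'o O'E] := within_continuous_open phic Oo.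
  have [|z [[Xz Cz] O'z]] := XU' x Xx O'.
    apply: open_nbhs_nbhs; split=> //.
    by have [] : (X `&` O') x by rewrite -O'E; split=> //=; rewrite xy.
  have [_ Oz] : (X `&` phi @^-1` O) z by rewrite O'E.
  by exists (phi z); split; [split=> //; apply: XY | apply: OB].
split; last exact: chart_inverse.
by apply: diag_map_morphism => x [Xx Cx]; split=> //; apply: XY.
Qed.

End Birationality.

Theorem proposition5p11 (R : realType) (n k : nat) (d : 'I_k -> nat)
    (k_gt0 : (0 < k)%N)
    (d_range : forall l : 'I_k, (1 <= d l <= n)%N)
    (d_incr : forall l m : 'I_k, (l < m)%N -> (d l < d m)%N) :
  birational_morphism (SpR R[i]%C n d) (SpF R[i]%C n d) (diag_map d_range) /\
  set_surj (SpR R[i]%C n d) (SpF R[i]%C n d) (diag_map d_range).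
Proof.
split; first exact: (@diag_map_birational R[i]%C).
move=> y Yy; have [x Xx xy] := @diag_map_surj R[i]%C _ _ _ d_range d_incr _ Yy.
by exists x.
Qed.
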